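(* Let $A$ be a quasi-hereditary algebra with a duality and with an exact Borel subalgebra $B$. Then $\mathrm{gl.dim}(A)\le 2\,\mathrm{gl.dim}(B)$.
   Context: Setting: $R$ is a commutative Artin ring; algebras are Artin $R$-algebras ($A$ basic) and modules are finitely generated left modules. Fix an ordered complete set $e_1,\dots,e_n$ of primitive orthogonal idempotents of $A$; put $\Lambda=\{1,\dots,n\}$ with its natural order. For $i\in\Lambda$, $P_A(i)=Ae_i$ and $E_A(i)$ is the simple top of $P_A(i)$. The standard module $\Delta_A(i)$ is the maximal factor module of $P_A(i)$ having no composition factor $E_A(j)$ with $j>i$. $\mathcal F(\Delta_A)$ is the full subcategory of $A\text{-mod}$ of modules having a finite filtration whose successive factors are isomorphic to standard modules $\Delta_A(i)$. $A$ is quasi-hereditary if ${}_AA\in\mathcal F(\Delta_A)$ and every $\mathrm{End}_A(\Delta_A(i))$ is a division ring; the same definitions apply to $B$. Duality: $A$ has a duality if there exists an involutory contravariant functor $\phi:A\text{-mod}\to A\text{-mod}$ preserving simple modules, i.e. $\phi(E_A(i))=E_A(i)$ (up to isomorphism) for all $i\in\Lambda$. Exact Borel subalgebra (in the sense of König): a subalgebra $B$ of the quasi-hereditary algebra $(A,\Lambda)$ such that (a) the simple $B$-modules $E_B(i)$ are indexed by the same ordered set $\Lambda$, and $(B,\Lambda)$ is quasi-hereditary with simple standard modules, i.e. $\Delta_B(i)=E_B(i)$ for all $i\in\Lambda$; (b) the functor $A\otimes_B-:B\text{-mod}\to A\text{-mod}$ is exact; (c) $A\otimes_B\Delta_B(i)\cong\Delta_A(i)$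 for all $i\in\Lambda$. *)

(* Defs.v *)
From HB Require Import structures.
From Stdlib Require List.
From mathcomp Require Import all_boot all_order ssralg ssrnum ssrint.
From mathcomp Require Import generic_quotient ring_quotient freeg.
From mathcomp Require Import boolp constructive_ereal.

Set Implicit Arguments.
Unset Strict Implicit.
Unset Printing Implicit Defensive.

Import GRing.Theory.
Local Open Scope ring_scope.
Local Open Scope quotient_scope.

Section Modules.
Variable A : pzRingType.
Implicit Types (L M N P E D : lmodType A).

Definition surj M N (f : M -> N) := forall y, exists x, f x = y.

Definition exact_at L M N (f : L -> M) (g : M -> N) :=
  forall y, g y = 0 <-> exists x, f x = y.

Definition short_exact L M N (f : L -> M) (g : M -> N) :=
  [/\ injective f, exact_at f g & surj g].

Definition iso_mod M N := exists f : {linear M -> N}, bijective f.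

Definition trivial_mod M := forall x : M, x = 0.

Definition finitely_generated M :=
  exists (m : nat) (s : 'I_m -> M),
    forall x, exists c : 'I_m -> A, x = \sum_(i < m) c i *: s i.

Definition artinian M :=
  forall U : nat -> {pred M},
    (forall k, submod_closed (U k)) ->
    (forall k, {subset U k.+1 <= U k}) ->
    exists m, forall k, (m <= k)%N -> U k =i U m.

Definition simple_mod M :=
  ~ trivial_mod M /\
  forall U : {pred M}, submod_closed U -> U =i pred1 0 \/ U =i predT.

Definition maximal_submod M (U : {pred M}) :=
  [/\ submod_closed U, ~ U =i predT
    & forall V : {pred M}, submod_closed V -> {subset U <= V} ->
        V =i U \/ V =i predT].

Definition in_rad M (x : M) :=
  forall U : {pred M}, maximal_submod U -> x \in U.

(* E is isomorphic to M / rad M and is simple *)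
Definition simple_top M E :=
  simple_mod E /\
  exists p : {linear M -> E}, surj p /\ forall x, p x = 0 <-> in_rad x.

(* [filtration s M]: there is a chain 0 = M_0 <= M_1 <= ... <= M_t = M whose
   successive factors M_k / M_(k-1) are, up to isomorphism and from the top
   down, the members of s.  Submodules and factors are given by short exact
   sequences. *)
Inductive filtration : seq (lmodType A) -> lmodType A -> Prop :=
| filtration_nil M : trivial_mod M -> filtration [::] M
| filtration_cons s L M N (f : {linear L -> M}) (g : {linear M -> N}) :
    short_exact f g -> filtration s L -> filtration (N :: s) M.

Definition composition_factor E M :=
  exists s, [/\ filtration s M, forall S, List.In S s -> simple_mod S
              & exists2 S, List.In S s & iso_mod S E].

Definition division_endomorphism_ring M :=
  ~ trivial_mod M /\
  forall f : {linear M -> M}, (exists x, f x != 0) ->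
    exists g : {linear M -> M}, cancel f g /\ cancel g f.

Definition projective P :=
  forall M N (g : {linear M -> N}) (h : {linear P -> N}),
    surj g -> exists k : {linear P -> M}, forall x, g (k x) = h x.

End Modules.

Record fgmod (A : pzRingType) := FgMod {
  fgmod_sort :> lmodType A;
  fgmodP : finitely_generated fgmod_sort }.

Record projective_resolution (A : pzRingType) (M : lmodType A) := ProjRes {
  pr_term :> nat -> lmodType A;
  pr_diff : forall k, {linear pr_term k.+1 -> pr_term k};
  pr_aug : {linear pr_term 0 -> M};
  pr_fg : forall k, finitely_generated (pr_term k);
  pr_proj : forall k, projective (pr_term k);
  pr_aug_surj : surj pr_aug;
  pr_aug_exact : exact_at (pr_diff 0) pr_aug;
  pr_exact : forall k, exact_at (pr_diff k.+1) (pr_diff k) }.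

(* minimum of a set of natural numbers, +oo when the set is empty *)
Definition least (P : nat -> Prop) : \bar int :=
  if pselect (exists d, `[< P d >]) is left h then ((ex_minn h)%:Z)%:E
  else +oo%E.

Lemma least_le (P : nat -> Prop) (d : nat) :
  (least P <= (d%:Z)%:E)%E <-> exists2 k, (k <= d)%N & P k.
Proof.
rewrite /least; case: pselect => [h|nh].
  case: ex_minnP => m /asboolP Pm m_min; rewrite lee_fin lez_nat.
  split=> [md|[k kd Pk]]; first by exists m.
  by apply: leq_trans kd; apply/m_min/asboolP.
split=> // -[k _ Pk]; case: nh; exists k; exact/asboolP.
Qed.

Definition pdim (A : pzRingType) (M : lmodType A) : \bar int :=
  least (fun d => exists P : projective_resolution M,
           forall k, (d < k)%N -> trivial_mod (P k)).

(* The least upper bound of a family in {0, 1, ..., +oo} is its least upper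
   bound in nat if there is one, and +oo otherwise. *)
Definition gldim (A : pzRingType) : \bar int :=
  least (fun d => forall M : fgmod A, (pdim M <= (d%:Z)%:E)%E).

Section LeftIdeal.
Variables (A : pzRingType) (e : A).

Definition in_Ae : {pred A^o} := fun x => `[< exists a : A, x = a * e >].

Lemma in_Ae_closed : submod_closed in_Ae.
Proof.
split; first by apply/asboolP; exists 0; rewrite mul0r.
move=> c _ _ /asboolP[a ->] /asboolP[b ->].
by apply/asboolP; exists (c * a + b); rewrite mulrDl -mulrA.
Qed.

Definition Ae := {x : A^o | in_Ae x}.

HB.instance Definition _ := SubType.on Ae.
HB.instance Definition _ := [Choice of Ae by <:].
HB.instance Definition _ :=
  GRing.SubChoice_isSubLmodule.Build A A^o in_Ae Ae in_Ae_closed.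

End LeftIdeal.

Section Labelling.
Variables (A : pzRingType) (n : nat) (e : 'I_n -> A).

Definition primitive_idempotent (x : A) :=
  [/\ x != 0, x * x = x
    & forall y z : A, y * y = y -> z * z = z -> y * z = 0 -> z * y = 0 ->
        x = y + z -> y = 0 \/ z = 0].

Definition complete_primitive_orthogonal :=
  [/\ forall i, primitive_idempotent (e i),
      forall i j, i != j -> e i * e j = 0
    & \sum_i e i = 1].

Definition basic := forall i j, iso_mod (Ae (e i)) (Ae (e j)) -> i = j.

Definition P_ (i : 'I_n) : lmodType A := Ae (e i).

(* S is isomorphic to E_A(i) *)
Definition is_E (i : 'I_n) (S : lmodType A) := simple_top (P_ i) S.

(* the simple modules are indexed by 'I_n, E_A(i) being the top of A e_i *)
Definition simples_indexed :=
  [/\ forall i, primitive_idempotent (e i),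
      forall i j S, is_E i S -> is_E j S -> i = j
    & forall S : lmodType A, simple_mod S -> exists i, is_E i S].

Definition no_factor_above (i : 'I_n) (M : lmodType A) :=
  forall (j : 'I_n) S, (i < j)%N -> is_E j S -> ~ composition_factor S M.

(* D is isomorphic to the standard module Delta_A(i): it is a factor module of
   P_A(i) without composition factor E_A(j), j > i, and every other such
   factor module is a factor of it. *)
Definition standard (i : 'I_n) (D : lmodType A) :=
  no_factor_above i D /\
  exists p : {linear P_ i -> D}, surj p /\
    forall (N : lmodType A) (g : {linear P_ i -> N}),
      surj g -> no_factor_above i N ->
      exists h : {linear D -> N}, forall x, g x = h (p x).

Definition F_Delta (M : lmodType A) :=
  exists2 s, filtration s M & forall D, List.In D s -> exists i, standard i D.

Definition quasi_hereditary :=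
  F_Delta A^o /\
  forall i D, standard i D -> division_endomorphism_ring D.

(* Morphisms are compared pointwise; "involutory" is taken up to natural
   isomorphism. *)
Record duality := Duality {
  dual :> fgmod A -> fgmod A;
  dual_map : forall M N : fgmod A, {linear M -> N} -> {linear dual N -> dual M};
  dual_ext : forall (M N : fgmod A) (f g : {linear M -> N}),
    f =1 g -> dual_map f =1 dual_map g;
  dual_id : forall M : fgmod A, dual_map (idfun : {linear M -> M}) =1 id;
  dual_comp : forall (L M N : fgmod A) (f : {linear L -> M})
      (g : {linear M -> N}),
    dual_map (g \o f : {linear L -> N}) =1 dual_map f \o dual_map g;
  dual_inv : forall M : fgmod A, {linear M -> dual (dual M)};
  dual_inv_bij : forall M : fgmod A, bijective (dual_inv M);
  dual_inv_nat : forall (M N : fgmod A) (f : {linear M -> N}),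
    dual_map (dual_map f) \o dual_inv M =1 dual_inv N \o f;
  dual_simple : forall (i : 'I_n) (S : fgmod A), is_E i S -> iso_mod (dual S) S }.

End Labelling.


Section FreeGroup.
Variables (K : choiceType) (V : zmodType).

(* the additive extension of f to the free abelian group on K; zmodule V is V
   with its canonical structure of module over int *)
Definition free_ext (f : K -> V) (D : {freeg K / int}) : V :=
  fglift (f : K -> zmodule V) D.

Lemma free_ext_additive f : zmod_morphism (free_ext f).
Proof. exact: (@lift_is_additive int K (zmodule V) f). Qed.

HB.instance Definition _ f :=
  GRing.isZmodMorphism.Build {freeg K / int} V (free_ext f)
    (free_ext_additive f).

Lemma free_ext1 f k : free_ext f << k >> = f k.
Proof. by rewrite /free_ext liftU scale1r. Qed.

Lemma free_eq (f g : {additive {freeg K / int} -> V}) :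
  (forall k, f << k >> = g << k >>) -> f =1 g.
Proof.
move=> fg D; rewrite -(freeg_sumE D) !raddf_sum /=; apply: eq_bigr => k _.
have -> : << coeff k D *g k >> = << k >> *~ coeff k D :> {freeg K / int}.
  by rewrite freeg_mulz intz.
by rewrite !raddfMz fg.
Qed.

End FreeGroup.

Section Tensor.
Variables (A B : pzRingType) (iota : {rmorphism B -> A}).

Section Module.
Variable M : lmodType B.

Let F := {freeg (A * M)%type / int}.

Inductive tensor_relation : F -> Prop :=
| tensor_relDl a a' m :
    tensor_relation (<< (a + a', m) >> - (<< (a, m) >> + << (a', m) >>))
| tensor_relDr a m m' :
    tensor_relation (<< (a, m + m') >> - (<< (a, m) >> + << (a, m') >>))
| tensor_relM a b m :
    tensor_relation (<< (a * iota b, m) >> - << (a, b *: m) >>).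

(* the subgroup generated by the relations *)
Definition tensor_null : {pred F} := fun x =>
  `[< forall U : {pred F}, zmod_closed U ->
        (forall r, tensor_relation r -> r \in U) -> x \in U >].

Lemma tensor_null_closed : zmod_closed tensor_null.
Proof.
split=> [|x y /asboolP xU /asboolP yU]; apply/asboolP => U Uc rU.
  by case: Uc.
by case: (Uc) => _; apply; [exact: xU | exact: yU].
Qed.

HB.instance Definition _ :=
  GRing.isZmodClosed.Build F tensor_null tensor_null_closed.

Definition tensor : Type := {ideal_quot tensor_null}.
HB.instance Definition _ := GRing.Zmodule.on tensor.

Definition tensor_pi (x : F) : tensor := \pi_{ideal_quot tensor_null} x.

(* a (x) m *)
Definition tensor_of (a : A) (m : M) : tensor := tensor_pi << (a, m) >>.

Lemma tensor_pi_eq x y : (tensor_pi x == tensor_pi y) = (x - y \in tensor_null).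
Proof. exact: (esym (Quotient.idealrBE tensor_null x y)). Qed.

Lemma tensor_piP (x : tensor) : exists y, x = tensor_pi y.
Proof.
by exists (repr (x : {ideal_quot tensor_null})); rewrite /tensor_pi reprK.
Qed.

Lemma tensor_pi_is_additive : zmod_morphism tensor_pi.
Proof.
move=> x y; rewrite /tensor_pi (@Quotient.pi_add _ tensor_null).
by rewrite (@Quotient.pi_opp _ tensor_null).
Qed.

HB.instance Definition _ :=
  GRing.isZmodMorphism.Build F tensor tensor_pi tensor_pi_is_additive.

Section Lift.
Variables (V : zmodType) (f : A -> M -> V).
Hypotheses (fDl : forall a a' m, f (a + a') m = f a m + f a' m)
  (fDr : forall a m m', f a (m + m') = f a m + f a m')
  (fM : forall a b m, f (a * iota b) m = f a (b *: m)).

Let f' : {additive F -> V} := free_ext (fun x : A * M => f x.1 x.2).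

Lemma tensor_lift_null x : x \in tensor_null -> f' x = 0.
Proof.
move=> /asboolP /(_ (fun x => f' x == 0)) H; apply/eqP; apply: H.
  split=> [|u v /eqP fu /eqP fv]; rewrite -topredE /= ?raddf0 //.
  by rewrite raddfB /= fu fv subrr.
move=> _ [a a' m|a m m'|a b m]; rewrite -topredE /= raddfB /=.
- by rewrite raddfD /= !free_ext1 /= fDl subrr.
- by rewrite raddfD /= !free_ext1 /= fDr subrr.
- by rewrite !free_ext1 /= fM subrr.
Qed.

Definition tensor_lift (x : tensor) : V :=
  f' (repr (x : {ideal_quot tensor_null})).

Lemma tensor_lift_pi x : tensor_lift (tensor_pi x) = f' x.
Proof.
apply/eqP; rewrite -subr_eq0 -raddfB; apply/eqP/tensor_lift_null.
by rewrite -tensor_pi_eq /tensor_pi reprK.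
Qed.

Lemma tensor_lift_is_additive : zmod_morphism tensor_lift.
Proof.
move=> x y; have [x' ->] := tensor_piP x; have [y' ->] := tensor_piP y.
by rewrite -raddfB !tensor_lift_pi raddfB.
Qed.

Lemma tensor_lift_of a m : tensor_lift (tensor_of a m) = f a m.
Proof. by rewrite tensor_lift_pi; apply: free_ext1. Qed.

End Lift.

Lemma tensor_ofDl a a' m :
  tensor_of (a + a') m = tensor_of a m + tensor_of a' m.
Proof.
apply/eqP; rewrite -raddfD tensor_pi_eq; apply/asboolP => U _; apply.
exact: tensor_relDl.
Qed.

Lemma tensor_ofDr a m m' :
  tensor_of a (m + m') = tensor_of a m + tensor_of a m'.
Proof.
apply/eqP; rewrite -raddfD tensor_pi_eq; apply/asboolP => U _; apply.
exact: tensor_relDr.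
Qed.

Lemma tensor_ofM a b m : tensor_of (a * iota b) m = tensor_of a (b *: m).
Proof.
apply/eqP; rewrite tensor_pi_eq; apply/asboolP => U _; apply.
exact: tensor_relM.
Qed.

Lemma tensor_eq (V : zmodType) (f g : {additive tensor -> V}) :
  (forall a m, f (tensor_of a m) = g (tensor_of a m)) -> f =1 g.
Proof.
move=> fg x; have [y ->] := tensor_piP x.
apply: (free_eq (f := f \o tensor_pi) (g := g \o tensor_pi)).
by case=> a m; apply: fg.
Qed.

Definition tensor_scale (a : A) : tensor -> tensor :=
  tensor_lift (fun a' m => tensor_of (a * a') m).

Lemma tensor_scale_is_additive a : zmod_morphism (tensor_scale a).
Proof.
apply: tensor_lift_is_additive => *.
- by rewrite mulrDr tensor_ofDl.
- by rewrite tensor_ofDr.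
- by rewrite mulrA tensor_ofM.
Qed.

HB.instance Definition _ a :=
  GRing.isZmodMorphism.Build tensor tensor (tensor_scale a)
    (tensor_scale_is_additive a).

Lemma tensor_scaleE a a' m :
  tensor_scale a (tensor_of a' m) = tensor_of (a * a') m.
Proof.
apply: tensor_lift_of => *.
- by rewrite mulrDr tensor_ofDl.
- by rewrite tensor_ofDr.
- by rewrite mulrA tensor_ofM.
Qed.

Lemma tensor_scaleA a b x :
  tensor_scale a (tensor_scale b x) = tensor_scale (a * b) x.
Proof.
apply: (tensor_eq (f := tensor_scale a \o tensor_scale b)
                  (g := tensor_scale (a * b))) => c m.
by rewrite /= !tensor_scaleE mulrA.
Qed.

Lemma tensor_scale1 : left_id 1 tensor_scale.
Proof.
move=> x; apply: (tensor_eq (f := tensor_scale 1) (g := idfun)) => c m.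
by rewrite /= tensor_scaleE mul1r.
Qed.

Lemma tensor_scaleDr : right_distributive tensor_scale +%R.
Proof. by move=> a x y; rewrite raddfD. Qed.

Lemma tensor_scaleDl x : {morph tensor_scale^~ x : a b / a + b}.
Proof.
move=> a b; apply: (tensor_eq (f := tensor_scale (a + b))
                              (g := tensor_scale a \+ tensor_scale b)) => c m.
by rewrite /= !tensor_scaleE mulrDl tensor_ofDl.
Qed.

HB.instance Definition _ := GRing.Zmodule_isLmodule.Build A tensor
  tensor_scaleA tensor_scale1 tensor_scaleDr tensor_scaleDl.

End Module.

Section Map.
Variables (M N : lmodType B) (h : {linear M -> N}).

(* A (x) h : a (x) m |-> a (x) h m *)
Definition tensor_map : tensor M -> tensor N :=
  tensor_lift (fun a m => tensor_of a (h m)).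

Lemma tensor_map_of a m : tensor_map (tensor_of a m) = tensor_of a (h m).
Proof.
apply: tensor_lift_of => *.
- by rewrite tensor_ofDl.
- by rewrite raddfD tensor_ofDr.
- by rewrite linearZ tensor_ofM.
Qed.

Lemma tensor_map_is_additive : zmod_morphism tensor_map.
Proof.
apply: tensor_lift_is_additive => *.
- by rewrite tensor_ofDl.
- by rewrite raddfD tensor_ofDr.
- by rewrite linearZ tensor_ofM.
Qed.

HB.instance Definition _ :=
  GRing.isZmodMorphism.Build (tensor M) (tensor N) tensor_map
    tensor_map_is_additive.

Lemma tensor_map_scalable : scalable tensor_map.
Proof.
move=> a; apply: (tensor_eq (f := tensor_map \o tensor_scale a)
                            (g := tensor_scale a \o tensor_map)) => c m.
by rewrite /= tensor_scaleE !tensor_map_of tensor_scaleE.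
Qed.

HB.instance Definition _ :=
  GRing.isScalable.Build A (tensor M) (tensor N) *:%R tensor_map
    tensor_map_scalable.

End Map.
End Tensor.

Arguments tensor_map {A B} iota {M N} h x.

Definition tensor_exact (A B : pzRingType) (iota : {rmorphism B -> A}) :=
  forall (L M N : fgmod B) (f : {linear L -> M}) (g : {linear M -> N}),
    short_exact f g -> short_exact (tensor_map iota f) (tensor_map iota g).

Definition artin_algebra (R : comNzRingType) (A : algType R) :=
  artinian R^o /\ finitely_generated (A : lmodType R).

(* f i is a primitive idempotent of B with E_B(i) the top of B f i; iota is the
   inclusion of the subalgebra B in A. *)
Definition exact_borel (R : comNzRingType) (A B : algType R) (n : nat)
    (e : 'I_n -> A) (f : 'I_n -> B) (iota : {lrmorphism B -> A}) :=
  [/\ injective iota,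
      simples_indexed f /\ quasi_hereditary f,
      forall i S, is_E f i S -> standard f i S,
      tensor_exact iota
    & forall i D, standard f i D -> standard e i (tensor iota D)].

(* Main.v *)
(** Assume [gldim B <= d].  Tensoring with [A] over [B] is exact and preserves
projectives, so [Delta i = A (x) E_B(i)] has projective dimension at most [d],
and by duality [nabla i = phi (Delta i)] has injective dimension at most [d].
Hence the [d]-th syzygy [X] of any module satisfies [Ext^1(X, nabla j) = 0] for
all [j], and it is enough to show that such an [X] has projective dimension at
most [d].

For [i] minimal such that [X] maps onto [E(i)], the embeddings of [E(j)] in
[nabla j] give [Ext^1(X, E(j)) = 0] for [j < i], hence [X -> E(i)] lifts to a
surjection [X -> Delta i].  Its kernel inherits the hypothesis on [X], because
[Ext^2(Delta i, nabla j) = 0]: by adjunction this is an [Ext^2] over [B], which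
vanishes since [Ext^1_A(Delta l, nabla j) = Ext^1_B(E_B(l), nabla j)] does so
for all [l].  An induction on [X] concludes, as modules are of finite length.

The multiplicity of [E(j)] in [M] enters only through the condition
[e_j M = 0].  That [A] and [B] are noetherian is read off from [gldim B <= d];
only the descending chain condition is taken from [R]. *)

Require Import Defs.
From HB Require Import structures.
From mathcomp Require Import all_boot all_order ssralg ssrnum ssrint.
From mathcomp Require Import boolp constructive_ereal.
From Stdlib Require List.
From mathcomp Require Import generic_quotient ring_quotient classical_sets.

Set Implicit Arguments.
Unset Strict Implicit.
Unset Printing Implicit Defensive.

Import GRing.Theory.
Local Open Scope ring_scope.

(** * Submodules, quotients and linear maps *)

(** The order of the labels drives the lifting step: the radical of [Delta i] has only factors E(j)
    with j < i, the cokernel of E(j) in the costandard module of j has only factors E(k) with k < j,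
    and minimality of i excludes nonzero morphisms from X to such a cokernel. The vanishing of Ext^2
    comes from an injectivity over B. As Ext^1 of every simple B-module into the restriction of a
    costandard module vanishes, so does Ext^1 of every finitely generated B-module. This applies to
    a first syzygy K of E_B(i), and A (x) K is a first syzygy of [Delta i]. The duality is a bare
    functor: preservation of zero morphisms and exactness are derived from its being fully faithful.
    It lives on finitely generated modules, so injectivity is tested on these only, and kernels must
    be known to be finitely generated. No Ext group is constructed: Ext^1(X, N) = 0 is an extension
    property, and higher vanishing is expressed through syzygies. *)

Section Submodules.
Variable A : pzRingType.
Implicit Types (L M N P Q X : lmodType A).

Lemma linear_exists M N (f : M -> N) :
  linear f -> exists g : {linear M -> N}, g =1 f.
Proof.
move=> f_lin.
pose g : {linear M -> N} := HB.pack f (GRing.isLinear.Build A M N _ f f_lin).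
by exists g.
Qed.

(** For morphisms described through non-unique preimages: single-valuedness of the graph takes the
    place of a choice of representatives. *)
Lemma linear_of_rel M N (T : M -> N -> Prop) :
  (forall x, exists y, T x y) ->
  (forall x y y', T x y -> T x y' -> y = y') ->
  (forall a x x' y y', T x y -> T x' y' -> T (a *: x + x') (a *: y + y')) ->
  exists g : {linear M -> N}, forall x, T x (g x).
Proof.
move=> /choice[g gT] T_fun T_lin.
have g_lin : linear g by move=> a x y; apply: T_fun (gT _) _; exact: T_lin.
by have [h hg] := linear_exists g_lin; exists h => x; rewrite hg.
Qed.

(** The [Prop]-valued form of [submod_closed], so that kernels, images and preimages need no
    booleans. *)
Definition submodule M (U : M -> Prop) :=
  U 0 /\ forall a x y, U x -> U y -> U (a *: x + y).

Lemma submoduleP M (U : {pred M}) : submodule (fun x => x \in U) <->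
  submod_closed U.
Proof. by split=> -[U0 Ulin]; split=> // a x y; apply: Ulin. Qed.

Lemma submodule_asbool M (U : M -> Prop) :
  submodule U -> submod_closed (fun x => `[< U x >]).
Proof.
move=> [U0 Ulin]; split; first exact/asboolP.
by move=> a x y /asboolP xU /asboolP yU; apply/asboolP/Ulin.
Qed.

Section SubmoduleFacts.
Variables (M : lmodType A) (U : M -> Prop).
Hypothesis Usub : submodule U.

Lemma sub0 : U 0. Proof. by case: Usub. Qed.

Lemma subD x y : U x -> U y -> U (x + y).
Proof. by move=> xU yU; rewrite -[x]scale1r; apply: Usub.2. Qed.

Lemma subZ a x : U x -> U (a *: x).
Proof. by move=> xU; rewrite -[_ *: _]addr0; apply: Usub.2 => //;
  apply: sub0. Qed.

Lemma subN x : U x -> U (- x).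
Proof. by rewrite -scaleN1r; apply: subZ. Qed.

Lemma subB x y : U x -> U y -> U (x - y).
Proof. by move=> xU yU; apply: subD => //; apply: subN. Qed.

Lemma subS (I : Type) (r : seq I) (F : I -> M) :
  (forall i, U (F i)) -> U (\sum_(i <- r) F i).
Proof. by move=> FU; elim/big_ind: _ => //; [exact: sub0 | exact: subD]. Qed.

End SubmoduleFacts.

Section SubmoduleType.
Variables (M : lmodType A) (U : {pred M}) (Uc : submod_closed U).

(** The closedness proof is an argument so that the instances can be inferred from the type
    [submod_of Uc] alone; [quot_pred] follows the same pattern. *)
Definition submod_of (_ : submod_closed U) := {x : M | U x}.
Local Notation S := (submod_of Uc).
HB.instance Definition _ := SubType.on S.
HB.instance Definition _ := [Choice of S by <:].
HB.instance Definition _ :=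
  GRing.SubChoice_isSubLmodule.Build A M U S Uc.

End SubmoduleType.

Lemma submodule_module M (U : M -> Prop) : submodule U ->
  exists (L : lmodType A) (f : {linear L -> M}),
    injective f /\ forall x, U x <-> exists y, f y = x.
Proof.
move=> /submodule_asbool Uc; pose L : lmodType A := submod_of Uc.
exists L, (val : {linear L -> M}); split; first exact: val_inj.
move=> x; split=> [xU|[y <-]]; last by case: y => y /= /asboolP.
have xU' : (fun x => `[< U x >]) x by apply/asboolP.
by exists (exist _ x xU' : L).
Qed.

Section QuotientType.
Variables (M : lmodType A) (U : {pred M}) (Uc : submod_closed U).

Definition quot_pred (_ : submod_closed U) : {pred M} := U.
HB.instance Definition _ := GRing.isZmodClosed.Build M (quot_pred Uc)
  (GRing.submod_closedB Uc).

Definition quot_of : Type := {ideal_quot quot_pred Uc}.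
HB.instance Definition _ := GRing.Zmodule.on quot_of.

Definition quot_pi (x : M) : quot_of :=
  (\pi_{ideal_quot quot_pred Uc} x)%qT.

Lemma quot_pi_eq x y : (quot_pi x = quot_pi y) <-> x - y \in U.
Proof.
have -> : (x - y \in U) = (quot_pi x == quot_pi y).
  exact: (Quotient.idealrBE (quot_pred Uc) x y).
by split=> /eqP.
Qed.

Lemma quot_piP (x : quot_of) : exists y, quot_pi y = x.
Proof. by exists (repr (x : {ideal_quot quot_pred Uc}));
  rewrite /quot_pi reprK. Qed.

Lemma quot_piB : zmod_morphism quot_pi.
Proof.
move=> x y; rewrite /quot_pi (@Quotient.pi_add _ (quot_pred Uc)).
by rewrite (@Quotient.pi_opp _ (quot_pred Uc)).
Qed.

HB.instance Definition _ :=
  GRing.isZmodMorphism.Build M quot_of quot_pi quot_piB.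

Definition quot_scale (a : A) (x : quot_of) : quot_of :=
  quot_pi (a *: repr (x : {ideal_quot quot_pred Uc})).

Lemma quot_scale_pi a x : quot_scale a (quot_pi x) = quot_pi (a *: x).
Proof.
apply/quot_pi_eq; rewrite -scalerBr.
have /submoduleP Us := Uc.
by apply: (subZ Us); apply/quot_pi_eq; rewrite /quot_pi reprK.
Qed.

Lemma quot_scaleA a b x : quot_scale a (quot_scale b x) = quot_scale (a * b) x.
Proof. by have [y <-] := quot_piP x; rewrite !quot_scale_pi scalerA. Qed.

Lemma quot_scale1 : left_id 1 quot_scale.
Proof. by move=> x; have [y <-] := quot_piP x;
  rewrite !quot_scale_pi scale1r. Qed.

Lemma quot_scaleDr : right_distributive quot_scale +%R.
Proof.
move=> a x y; have [x' <-] := quot_piP x; have [y' <-] := quot_piP y.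
by rewrite -raddfD !quot_scale_pi scalerDr raddfD.
Qed.

Lemma quot_scaleDl x : {morph quot_scale^~ x : a b / a + b}.
Proof.
move=> a b; have [x' <-] := quot_piP x.
by rewrite !quot_scale_pi scalerDl raddfD.
Qed.

HB.instance Definition _ := GRing.Zmodule_isLmodule.Build A quot_of
  quot_scaleA quot_scale1 quot_scaleDr quot_scaleDl.

Lemma quot_pi_scalable : scalable quot_pi.
Proof. by move=> a x; rewrite -quot_scale_pi. Qed.

HB.instance Definition _ :=
  GRing.isScalable.Build A M quot_of *:%R quot_pi quot_pi_scalable.

End QuotientType.

Lemma quotient_module M (U : M -> Prop) : submodule U ->
  exists (N : lmodType A) (g : {linear M -> N}),
    surj g /\ forall x, g x = 0 <-> U x.
Proof.
move=> /submodule_asbool Uc; pose N : lmodType A := quot_of Uc.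
exists N, (@quot_pi M _ Uc : {linear M -> N}); split; first exact: quot_piP.
move=> x; have := quot_pi_eq Uc x 0.
by rewrite raddf0 subr0 => ->; split=> /asboolP.
Qed.

Lemma factor_surj M N Q (g : {linear M -> N}) (h : {linear M -> Q}) :
  surj g -> (forall x, g x = 0 -> h x = 0) ->
  exists k : {linear N -> Q}, forall x, k (g x) = h x.
Proof.
move=> g_surj gh.
have [|y z z'||k Tk] :=
    @linear_of_rel N Q (fun y z => exists2 x, g x = y & h x = z).
- by move=> y; have [x <-] := g_surj y; exists (h x), x.
- move=> [x <- <-] [x' gx <-]; apply/esym/eqP; rewrite -subr_eq0 -linearB.
  by rewrite gh // linearB gx subrr.
- move=> a _ _ _ _ [x <- <-] [x' <- <-].
  by exists (a *: x + x'); rewrite linearP.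
exists k => x; have [x' gx <-] := Tk (g x).
by apply/eqP; rewrite -subr_eq0 -linearB gh // linearB gx subrr.
Qed.

Lemma factor_inj L M Q (f : {linear L -> M}) (h : {linear Q -> M}) :
  injective f -> (forall x, exists y, f y = h x) ->
  exists k : {linear Q -> L}, forall x, f (k x) = h x.
Proof.
move=> f_inj fh; apply: (linear_of_rel (T := fun x y => f y = h x)) => //.
- by move=> x y y' <- /f_inj.
- by move=> a x x' y y' yE y'E; rewrite !linearP yE y'E.
Qed.

Lemma submodule_ker M N (g : {linear M -> N}) : submodule (fun x => g x = 0).
Proof.
by split=> [|a x y gx gy]; rewrite ?raddf0 // linearP gx gy scaler0 addr0.
Qed.

Lemma submodule_im L M (f : {linear L -> M}) : submodule (fun x => exists y,
  f y = x).
Proof.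
split=> [|a _ _ [x <-] [y <-]]; first by exists 0; rewrite raddf0.
by exists (a *: x + y); rewrite linearP.
Qed.

Lemma submodule_preim L M (f : {linear L -> M}) U :
  submodule U -> submodule (fun x => U (f x)).
Proof.
move=> Us; split=> [|a x y xU yU]; first by rewrite raddf0; apply: sub0.
by rewrite linearP; apply: Us.2.
Qed.

Lemma linear_eq0_inj M N (f : {linear M -> N}) :
  (forall x, f x = 0 -> x = 0) -> injective f.
Proof.
move=> f0 x y /eqP; rewrite -subr_eq0 -raddfB => /eqP /f0 /eqP.
by rewrite subr_eq0 => /eqP.
Qed.

Lemma kernel_module M N (g : {linear M -> N}) : surj g ->
  exists (L : lmodType A) (f : {linear L -> M}), short_exact f g.
Proof.
move=> g_surj; have [L [f [f_inj fE]]] := submodule_module (submodule_ker g).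
by exists L, f.
Qed.

Lemma image_module M N (h : {linear M -> N}) :
  exists (Q : lmodType A) (f : {linear Q -> N}) (g : {linear M -> Q}),
    [/\ injective f, surj g & forall x, f (g x) = h x].
Proof.
have [Q [f [f_inj fE]]] := submodule_module (submodule_im h).
have [x|g gE] := factor_inj f_inj (h := h); first by apply/fE; exists x.
exists Q, f, g; split=> // y.
by have [|x hx] := (fE (f y)).2; [exists y | exists x; apply: f_inj;
  rewrite gE].
Qed.

Lemma short_exact0 L M N (f : {linear L -> M}) (g : {linear M -> N}) :
  short_exact f g -> forall x, g (f x) = 0.
Proof. by case=> _ fg _ x; apply/fg; exists x. Qed.

Lemma bijective_iso M N (f : {linear M -> N}) :
  bijective f -> exists g : {linear N -> M}, cancel f g /\ cancel g f.
Proof.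
case=> g fK gK; have [//|k kE] :=
  @factor_inj M N N f idfun (bij_inj (Bijective fK gK)).
  by move=> x; exists (g x); rewrite gK.
exists k; split=> x; last exact: kE.
by apply: (can_inj fK); rewrite kE.
Qed.

Lemma inj_surj_bij M N (f : {linear M -> N}) :
  injective f -> surj f -> bijective f.
Proof.
move=> f_inj f_surj; have [g gE] := choice f_surj.
by exists g => // x; apply: f_inj; rewrite gE.
Qed.

End Submodules.

(** * Finitely generated modules *)

Section FiniteGeneration.
Variable A : pzRingType.
Implicit Types (L M N P Q X S : lmodType A).

(** The right-hand side is an induction principle: a property that defines a submodule is checked on
    generators, without handling coefficients. *)
Lemma fgP M : finitely_generated M <->
  exists s : seq M, forall U, submodule U -> (forall y, y \in s -> U y) ->
    forall x, U x.
Proof.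
split=> [[m [s sM]]|[s sM]].
  exists (codom s) => U Us sU x; have [c ->] := sM x.
  by apply: (subS Us) => i; apply: (subZ Us); apply/sU/codom_f.
exists (size s), (tnth (in_tuple s)); apply: sM.
  split=> [|a _ _ [c ->] [d ->]].
    by exists (fun=> 0); rewrite big1 // => i _; rewrite scale0r.
  exists (fun i => a * c i + d i); rewrite scaler_sumr -big_split /=.
  by apply: eq_bigr => i _; rewrite scalerDl scalerA.
move=> y ys; have /seq_tnthP[i ->] := ys.
exists (fun j => (j == i)%:R); rewrite (bigD1 i) //= eqxx scale1r.
by rewrite big1 ?addr0 // => j /negPf ->; rewrite scale0r.
Qed.

Lemma fg_surj M N (g : {linear M -> N}) :
  surj g -> finitely_generated M -> finitely_generated N.
Proof.
move=> g_surj /fgP[s sM]; apply/fgP; exists (map g s) => U Us sU y.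
have [x <-] := g_surj y; apply: (sM (fun x => U (g x))) => [|z zs].
  exact: submodule_preim.
exact/sU/map_f.
Qed.

Lemma fg_ext L M N (f : {linear L -> M}) (g : {linear M -> N}) :
  short_exact f g -> finitely_generated L -> finitely_generated N ->
  finitely_generated M.
Proof.
case=> _ fg g_surj /fgP[s sL] /fgP[t tN].
have [h hK] := choice g_surj.
apply/fgP; exists (map f s ++ map h t) => U Us stU.
have fU x : U (f x).
  apply: (sL _ (submodule_preim f Us)) => y ys; apply: stU.
  by rewrite mem_cat map_f.
have gU : forall y, exists2 x, g x = y & U x.
  apply: tN => [|y yt].
    split=> [|a _ _ [x <- xU] [y <- yU]].
      by exists 0; rewrite ?linear0 //; apply: sub0.
    by exists (a *: x + y); rewrite ?linearP //; apply: Us.2.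
  by exists (h y) => //; apply: stU; rewrite mem_cat map_f ?orbT.
move=> x; have [x' gx xU] := gU (g x).
have [|y fy] := (fg (x - x')).1; first by rewrite linearB gx subrr.
by rewrite -(subrK x' x) -fy; apply: subD.
Qed.

Lemma ffun_linear N (m : nat) (t : 'I_m -> N) :
  exists k : {linear {ffun 'I_m -> A^o} -> N},
    forall x, k x = \sum_i (x i : A) *: t i.
Proof.
apply: linear_exists => a x y; rewrite scaler_sumr -big_split /=.
by apply: eq_bigr => i _; rewrite !ffunE scalerDl scalerA.
Qed.

Lemma ffun_basis (m : nat) (x : {ffun 'I_m -> A^o}) :
  x = \sum_i (x i : A) *: [ffun j => (j == i)%:R : A^o].
Proof.
apply/ffunP => j; rewrite sum_ffunE (bigD1 j) //= big1 ?addr0.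
  by rewrite !ffunE eqxx /GRing.scale /= mulr1.
by move=> i ij; rewrite !ffunE eq_sym (negPf ij) scaler0.
Qed.

Lemma free_cover M : finitely_generated M ->
  exists P (g : {linear P -> M}), [/\ finitely_generated P, projective P &
    surj g].
Proof.
case=> m [s sM]; exists {ffun 'I_m -> A^o}; have [g gE] := ffun_linear s.
exists g; split=> [||y]; last first.
- by have [c ->] := sM y; exists (finfun c); rewrite gE; apply: eq_bigr => i;
    rewrite ffunE.
- move=> X N p h p_surj; pose d i : {ffun 'I_m -> A^o} :=
    [ffun j => (j == i)%:R].
  have [t tE] := choice (fun i => p_surj (h (d i))).
  have [k kE] := ffun_linear t; exists k => x.
  rewrite kE [in RHS](ffun_basis x) !linear_sum; apply: eq_bigr => i _.
  by rewrite !linearZ -tE.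
- exists m, (fun i => [ffun j => (j == i)%:R]) => x; exists x;
    exact: ffun_basis.
Qed.

Lemma projective_trivial P : trivial_mod P -> projective P.
Proof.
move=> P0 M N g h _; have [|k _] := @linear_exists A P M (fun=> 0).
  by move=> a x y; rewrite scaler0 addr0.
by exists k => x; rewrite (P0 x) !linear0.
Qed.

Lemma trivial_exists : exists P, trivial_mod P.
Proof. by exists {ffun 'I_0 -> A^o} => x; apply/ffunP => -[]. Qed.

Lemma fg_trivial M : trivial_mod M -> finitely_generated M.
Proof. by move=> M0; apply/fgP; exists [::] => U Us _ x; rewrite (M0 x);
  apply: sub0. Qed.

Lemma projective_pair P Q : projective P -> projective Q ->
  projective (P * Q)%type.
Proof.
move=> Pp Qp M N g h g_surj.
have [|h1 h1E] := @linear_exists A P N (fun x => h (x, 0)).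
  by move=> a x y; rewrite -linearP; congr (h _); congr pair;
    rewrite /= scaler0 addr0.
have [|h2 h2E] := @linear_exists A Q N (fun x => h (0, x)).
  by move=> a x y; rewrite -linearP; congr (h _); congr pair;
    rewrite /= scaler0 addr0.
have [k1 k1E] := Pp _ _ g h1 g_surj; have [k2 k2E] := Qp _ _ g h2 g_surj.
have [|k kE] := @linear_exists A (P * Q)%type M (fun x => k1 x.1 + k2 x.2).
  by move=> a x y; rewrite /= !linearP scalerDr addrACA.
exists k => -[x y]; rewrite kE linearD /= k1E k2E h1E h2E -linearD.
by congr (h _); congr pair; rewrite /= ?addr0 ?add0r.
Qed.

Lemma fg_pair P Q : finitely_generated P -> finitely_generated Q ->
  finitely_generated (P * Q)%type.
Proof.
move=> Pfg Qfg.
have [|i iE] := @linear_exists A P (P * Q)%type (fun x => (x, 0)).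
  by move=> a x y; congr pair; rewrite /= scaler0 addr0.
have [//|p pE] := @linear_exists A (P * Q)%type Q snd.
apply: (@fg_ext P _ Q i p) => //; split=> [x y|[x y]|y].
- by rewrite !iE => -[].
- rewrite pE; split=> [/= ->|[x' <-]]; first by exists x; rewrite iE.
  by rewrite iE.
- by exists (0, y); rewrite pE.
Qed.

Lemma simpleP S (U : S -> Prop) : simple_mod S -> submodule U ->
  (forall x, U x -> x = 0) \/ forall x, U x.
Proof.
case=> _ /[swap] /submodule_asbool Us /(_ _ Us)[UE|UE]; [left|right] => x.
  by move=> xU; apply/eqP; have := UE x; rewrite inE => <-; apply/asboolP.
by apply/asboolP; have := UE x; rewrite inE.
Qed.

Lemma simpleI S : ~ trivial_mod S ->
  (forall U : S -> Prop, submodule U -> (forall x, U x -> x = 0) \/ forall x,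
    U x) ->
  simple_mod S.
Proof.
move=> S0 SU; split=> // U Uc; have /submoduleP Us := Uc.
have [U0|UT] := SU _ Us; [left|right] => x; last by rewrite UT.
rewrite !inE; apply/idP/eqP => [/U0 //|->]; exact: (sub0 Us).
Qed.

Lemma nontrivial_ex M : ~ trivial_mod M -> exists x : M, x <> 0.
Proof. by move=> M0; apply: contrapT => H; apply: M0 => x;
  apply: contrapT => x0; apply: H; exists x. Qed.

Lemma simple_surj M S (h : {linear M -> S}) x :
  simple_mod S -> h x <> 0 -> surj h.
Proof.
move=> Ssim hx; have [h0|//] := simpleP Ssim (submodule_im h).
by case: hx; apply: h0; exists x.
Qed.

(* A chain of proper submodules has a proper union, since finitely many
   generators would all lie in one member of the chain. *)
Lemma simple_quotient M : finitely_generated M -> ~ trivial_mod M ->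
  exists S (g : {linear M -> S}), simple_mod S /\ surj g.
Proof.
move=> /fgP[s sM] M0.
pose Z (U : set M) := U = (fun=> False) \/ (submodule U /\ exists x, ~ U x).
have [|U [ZU Umax]] := @Zorn_bigcup M Z.
  move=> F FZ Ftot.
  have [[U0 FU0 [y0 Uy0]]|F0] := pselect (exists2 U, F U & exists y, U y);
    last first.
    left; apply/funext => x; apply/propext; split=> // -[U FU Ux]; apply: F0;
      by exists U => //; exists x.
  have FS U : F U -> (exists x, U x) -> submodule U /\ exists x, ~ U x.
    by move=> FU [x Ux]; have [U0e|//] := FZ _ FU; rewrite U0e in Ux.
  have tot U V : F U -> F V -> (U `<=` V \/ V `<=` U)%classic by exact: Ftot.
  right; split.
    split; first by exists U0 => //; apply: sub0; apply: (FS _ _ _).1 => //;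
      exists y0.
    move=> a x y [U FU Ux] [V FV Vy].
    have [UV|VU] := tot U V FU FV.
      by exists V => //; apply: (FS V FV _).1.2 => //; [exists y|apply: UV].
    by exists U => //; apply: (FS U FU _).1.2 => //; [exists x|apply: VU].
  apply: contrapT => nx.
  have all x : (\bigcup_(X in F) X)%classic x by apply: contrapT => ?;
    apply: nx; exists x.
  have [V FV sV] : exists2 V, F V & (exists x, V x) /\ forall y, y \in s -> V y.
    elim: (s) => [|y t [V FV [V0 tV]]]; first by exists U0 => //; split => //;
      exists y0.
    have [W FW Wy] := all y; have [VW|WV] := tot V W FV FW.
      exists W => //; split; first by exists y.
      by move=> z; rewrite inE => /orP[/eqP->//|/tV/VW].
    exists V => //; split=> // z; rewrite inE => /orP[/eqP->|/tV//]; exact: WV.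
  have [Vs [x]] := FS V FV sV.1; apply; exact: sM Vs sV.2 x.
have [Us [x0 Ux0]] : submodule U /\ exists x, ~ U x.
  case: ZU => // U0; exfalso; apply: (Umax (fun x => x = 0)).
    by rewrite U0; split=> [x //|/(_ 0 erefl)].
  right; split; last exact: nontrivial_ex.
  by split=> // a x y -> ->; rewrite scaler0 addr0.
have [S [g [g_surj gU]]] := quotient_module Us.
exists S, g; split=> //; apply: simpleI.
  by move=> S0; apply: Ux0; apply/gU; apply: S0.
move=> V Vs; apply: contrapT => /not_orP[V0 VT].
have [y [Vy y0]] : exists y, V y /\ y <> 0.
  by apply: contrapT => H; apply: V0 => y Vy; apply: contrapT => y0; apply: H;
    exists y.
apply: (Umax (fun x => V (g x))).
  split; first by move=> x Ux; rewrite (gU x).2 //; apply: sub0.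
  have [x gx] := g_surj y; move=> /(_ x); rewrite gx => /(_ Vy) /gU.
  by rewrite gx.
right; split; first exact: submodule_preim.
apply: contrapT => H; apply: VT => z; have [x <-] := g_surj z.
by apply: contrapT => Vx; apply: H; exists x.
Qed.

End FiniteGeneration.

(** * Descending chains and induction over proper submodules *)

Section ChainConditions.
Variable A : pzRingType.
Implicit Types (L M N P Q X S : lmodType A).

Definition fg_submodules := forall L M (f : {linear L -> M}),
  injective f -> finitely_generated M -> finitely_generated L.

(** Without a minimal member each one has a strictly smaller successor, and iterating a choice of
    successors gives a descending chain that never stops. *)
Lemma artinian_min M (Z : (M -> Prop) -> Prop) U0 :
  artinian M -> submodule U0 -> Z U0 ->
  exists U, [/\ submodule U, Z U & forall V, submodule V -> Z V ->
    (forall x, V x -> U x) -> forall x, U x -> V x].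
Proof.
move=> Mart U0s ZU0; apply: contrapT => nmin.
pose T := {U : M -> Prop | submodule U /\ Z U}.
have next (t : T) : exists t' : T, (forall x, sval t' x -> sval t x) /\
    exists x, sval t x /\ ~ sval t' x.
  case: t => U [Us ZU] /=; apply: contrapT => nt; apply: nmin; exists U;
    split=> //.
  move=> V Vs ZV VU x Ux; apply: contrapT => nVx; apply: nt.
  by exists (exist _ V (conj Vs ZV)) => /=; split=> //; exists x.
have [F FE] := choice next.
pose W k := iter k F (exist _ U0 (conj U0s ZU0)).
have [||m mE] := Mart (fun k => (fun x => `[< sval (W k) x >])).
- by move=> k; apply: submodule_asbool; have := svalP (W k); case.
- by move=> k x /asboolP xW; apply/asboolP; apply: (FE (W k)).1.
have [x [Wx nWx]] := (FE (W m)).2.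
have : x \in (fun x => `[< sval (W m) x >]) by apply/asboolP.
by rewrite -(mE m.+1) // => /asboolP.
Qed.

(** Induction on the generators. The coefficients of the first generator in elements of [U k] form a
    descending chain of left ideals; once it stops, two elements with the same coefficient differ by
    an element in the span of the other generators. *)
Lemma fg_artinian M : artinian A^o -> finitely_generated M -> artinian M.
Proof.
move=> Aart /fgP[s sM] U Uc Udec.
have Us k : submodule (fun x => x \in U k) by apply/submoduleP.
have Ule k l : (k <= l)%N -> {subset U l <= U k}.
  move=> /subnK <-; elim: (l - k)%N => [//|j IH] x /Udec; exact: IH.
pose span := fix span (t : seq M) x :=
  if t is v :: t' then exists (a : A) y, span t' y /\ x = a *: v + y else x = 0.
have span_sub t : submodule (span t).
  elim: t => [|v t IH]; first by split=> //= a x y -> ->; rewrite scaler0 addr0.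
  split; first by exists 0, 0; rewrite scale0r addr0; split=> //; apply: sub0.
  move=> a _ _ [b [y [yt ->]]] [c [z [zt ->]]];
    exists (a * b + c), (a *: y + z).
  by split; [exact: IH.2 | rewrite scalerDl scalerDr addrACA scalerA].
have span_mem t y : y \in t -> span t y.
  elim: t => // v t IH; rewrite inE => /orP[/eqP->|yt].
    by exists 1, 0; rewrite scale1r addr0; split=> //; apply: sub0.
  by exists 0, y; rewrite scale0r add0r; split=> //; apply: IH.
have [m mE] : exists m, forall k, (m <= k)%N -> forall x, span s x ->
  x \in U m -> x \in U k.
  elim: (s) => [|v t [m1 IH]].
    by exists 0%N => k _ x /= -> _; apply: (sub0 (Us k)).
  pose I k (a : A^o) := exists2 y, span t y & (a : A) *: v + y \in U k.
  have [||m2 IE] := Aart (fun k a => `[< I k a >]).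
  - move=> k; apply: submodule_asbool; split.
      by exists 0; [exact: sub0 | rewrite scale0r addr0; apply: (sub0 (Us k))].
    move=> a b c [y yt yU] [z zt zU]; exists (a *: y + z);
      first exact: (span_sub t).2.
    have := (Us k).2 a _ _ yU zU; rewrite scalerDr addrACA scalerA -scalerDl.
    exact.
  - by move=> k a /asboolP[y yt yU]; apply/asboolP; exists y => //; apply: Udec.
  exists (maxn m1 m2) => k; rewrite geq_max => /andP[m1k m2k] _ [a [y [yt
    ->]]] xU.
  have /asboolP[z zt zU] : (a : A^o) \in (fun a => `[< I k a >]).
    rewrite (IE k m2k) -(IE (maxn m1 m2)) ?leq_maxr //.
    by apply/asboolP; exists y.
  have -> : a *: v + y = (a *: v + z) + (y - z) by rewrite -addrA [z + _]addrC
    subrK.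
  apply: (subD (Us k)) => //; apply: IH => //;
    first by apply: (subB (span_sub t)).
  rewrite (_ : y - z = (a *: v + y) - (a *: v + z));
    last by rewrite opprD addrACA subrr add0r.
  apply: (subB (Us m1)); first by apply: Ule xU; rewrite leq_maxl.
  exact: Ule zU.
exists m => k mk x; apply/idP/idP; first exact: Ule.
by apply: mE => //; exact: (sM _ (span_sub s) (span_mem s)).
Qed.

(** Takes the place of induction on length: a minimal submodule for which [Q] fails contradicts the
    induction step. *)
Lemma submodule_ind (Q : lmodType A -> Prop) :
  artinian A^o ->
  (forall M, finitely_generated M ->
    (forall L (f : {linear L -> M}), injective f -> ~ surj f ->
      finitely_generated L -> Q L) -> Q M) ->
  forall M, finitely_generated M -> Q M.
Proof.
move=> Aart IH M Mfg; apply: contrapT => nQ.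
pose Z (U : M -> Prop) := exists L (f : {linear L -> M}),
  [/\ injective f, forall x, U x <-> exists y, f y = x, finitely_generated L &
    ~ Q L].
have [|U [Us [L [f [f_inj fU Lfg nQL]]] Umin]] :=
    @artinian_min M Z (fun=> True) (fg_artinian Aart Mfg) (conj I (fun _ _ _ _
      _ => I)).
  by exists M, idfun; split=> // x; split=> // _; exists x.
apply: nQL; apply: IH => // K g g_inj g_nsurj Kfg; apply: contrapT => nQK.
apply: g_nsurj => y; pose h : {linear K -> M} := f \o g.
have [z /f_inj gz] : exists z, h z = f y; last by exists z.
apply: (Umin _ (submodule_im h)) => [|x [z <-]|].
- by exists K, h; split=> //; exact: inj_comp.
- by apply/fU; exists (g z).
- by apply/fU; exists y.
Qed.

End ChainConditions.

(** * Projective dimension and syzygies *)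

Section ProjectiveDimension.
Variable A : pzRingType.
Implicit Types (K L M N P Q X S : lmodType A).

(** Peels one syzygy off at a time, which suits induction better than a whole resolution; [pdim_le]
    relates it to [pdim]. *)
Fixpoint pd_le (d : nat) M : Prop :=
  if d is d'.+1 then
    exists K P (f : {linear K -> P}) (g : {linear P -> M}),
      [/\ finitely_generated P, projective P, short_exact f g & pd_le d' K]
  else finitely_generated M /\ projective M.

Lemma pd_le_fg d M : pd_le d M -> finitely_generated M.
Proof. by case: d => [[]//|d [K [P [f [g [Pfg _ [_ _ g_surj] _]]]]]];
  apply: fg_surj Pfg. Qed.

Lemma projective_iso M N (f : {linear M -> N}) :
  bijective f -> projective M -> projective N.
Proof.
move=> /bijective_iso[g [fK gK]] Mp X Y p h p_surj.
have [k kE] := Mp _ _ p (h \o f : {linear M -> Y}) p_surj.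
by exists (k \o g : {linear N -> X}) => x /=; rewrite kE /= gK.
Qed.

Lemma short_exact_isor L M N N' (f : {linear L -> M}) (g : {linear M -> N})
    (h : {linear N -> N'}) :
  bijective h -> short_exact f g -> short_exact f (h \o g).
Proof.
move=> h_bij [f_inj fg g_surj]; split=> //.
  move=> y /=; rewrite -(linear0 h); split=> [/(bij_inj h_bij) /fg //|/fg ->//].
by move=> y; have [h' _ h'K] := h_bij; have [x gx] := g_surj (h' y); exists x;
  rewrite /= gx h'K.
Qed.

Lemma pd_le_iso d M N (f : {linear M -> N}) : bijective f -> pd_le d M ->
  pd_le d N.
Proof.
move=> f_bij; case: d => [[Mfg Mp]|d [K [P [i [g [Pfg Pp ig Kd]]]]]] /=.
  split; last exact: projective_iso f_bij Mp.
  by apply: (fg_surj (g := f)) Mfg => y; have [f' _ f'K] := f_bij;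
    exists (f' y).
by exists K, P, i, (f \o g : {linear P -> N}); split=> //;
  apply: short_exact_isor.
Qed.

Lemma short_exact_trivial K M : trivial_mod K ->
  exists f : {linear K -> M}, short_exact f (idfun : {linear M -> M}).
Proof.
move=> K0; have [|f fE] := @linear_exists A K M (fun=> 0).
  by move=> a x y; rewrite scaler0 addr0.
exists f; split=> [x y _|y|y]; [by rewrite (K0 x) (K0 y)| |by exists y].
by split=> [/= ->|[x <-] /=]; [exists 0; rewrite linear0 | rewrite fE].
Qed.

Lemma pd_le_trivial d M : trivial_mod M -> pd_le d M.
Proof.
move=> M0; elim: d => [|d IH]; first by split;
  [exact: fg_trivial | exact: projective_trivial].
have [f fE] := short_exact_trivial M M0.
by exists M, M, f, idfun; split=> //;
  [exact: fg_trivial | exact: projective_trivial].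
Qed.

Lemma pd_leS d M : pd_le d M -> pd_le d.+1 M.
Proof.
elim: d M => [M [Mfg Mp]|d IH M [K [P [f [g [Pfg Pp fg Kd]]]]]]; last first.
  by exists K, P, f, g; split=> //; apply: IH.
have [Z Z0] := trivial_exists A; have [f fE] := short_exact_trivial M Z0.
by exists Z, M, f, idfun; split=> //; apply: pd_le_trivial.
Qed.

Lemma pd_leW d d' M : (d <= d')%N -> pd_le d M -> pd_le d' M.
Proof. by move=> /subnK <-; elim: (d' - d)%N => // k IH /IH; exact: pd_leS. Qed.

Lemma pd_le_resolution d M : pd_le d M ->
  exists P : projective_resolution M, forall k, (d < k)%N -> trivial_mod (P k).
Proof.
elim: d M => [M [Mfg Mp]|d IH M [K [P [f [g [Pfg Pp [f_inj fg g_surj] /IH[R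
  RE]]]]]]].
  have [Z Z0] := trivial_exists A.
  pose T k := if k is _.+1 then Z else M.
  have [|zM _] := @linear_exists A Z M (fun=> 0).
    by move=> a x y; rewrite scaler0 addr0.
  pose d k : {linear T k.+1 -> T k} :=
    match k with 0%N => zM | _.+1 => (idfun : {linear Z -> Z}) end.
  unshelve eexists (@ProjRes A M T d idfun _ _ _ _ _).
  - by case=> //= _; apply: fg_trivial.
  - by case=> //= _; apply: projective_trivial.
  - by move=> y; exists y.
  - move=> y; split=> [/= ->|[x <-]]; first by exists 0; rewrite linear0.
    by rewrite (Z0 x) linear0.
  - case=> [|k] y /=; split=> [_|_]; first by exists y.
    + by rewrite (Z0 y) linear0.
    + by exists y.
    + exact: Z0.
  - by case.
pose T k := if k is k'.+1 then R k' else P.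
pose d' k : {linear T k.+1 -> T k} :=
  match k with 0%N => (f \o pr_aug R : {linear R 0 -> P}) |
    k'.+1 => pr_diff R k' end.
unshelve eexists (@ProjRes A M T d' g _ _ g_surj _ _).
- by case=> //= k; apply: pr_fg.
- by case=> //= k; apply: pr_proj.
- move=> y; split=> [/fg[x <-]|[x <-]].
    by have [z <-] := pr_aug_surj R x; exists z.
  by apply/fg; exists (pr_aug R x).
- case=> [|k] y /=; last exact: pr_exact.
  split=> [fy|/(pr_aug_exact (p := R) y) ->]; last by rewrite linear0.
  by apply/(pr_aug_exact (p := R) y)/f_inj; rewrite fy linear0.
- by case=> // k; rewrite ltnS; apply: RE.
Qed.

Lemma resolution_pd_le d M (P : projective_resolution M) :
  (forall k, (d < k)%N -> trivial_mod (P k)) -> pd_le d M.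
Proof.
elim: d M P => [|d IH] M P P0.
  apply: (@pd_le_iso 0 (P 0%N) M (pr_aug P)); last by split;
    [exact: pr_fg | exact: pr_proj].
  apply: inj_surj_bij; last exact: pr_aug_surj.
  apply: linear_eq0_inj => x /(pr_aug_exact (p := P))[y <-].
  by rewrite (P0 1%N _ y) // linear0.
have [K [f fg]] := kernel_module (pr_aug_surj P).
have [f_inj fgE g_surj] := fg.
have [x|a aE] := factor_inj f_inj (h := pr_diff P 0).
  by apply/fgE/(pr_aug_exact (p := P)); exists x.
exists K, (P 0%N), f, (pr_aug P); split=> //; [exact: pr_fg | exact: pr_proj |].
unshelve eapply (IH K (@ProjRes A K (fun k => P k.+1) (fun k => pr_diff P
  k.+1) a _ _ _ _ _)).
- by move=> k; apply: pr_fg.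
- by move=> k; apply: pr_proj.
- move=> y; have [|x dx] := (pr_aug_exact (p := P) (f y)).1;
    first by apply/fgE; exists y.
  by exists x; apply: f_inj; rewrite aE.
- move=> y; rewrite -(pr_exact (p := P)); split=> [ay|dy];
    first by rewrite -aE ay linear0.
  by apply: f_inj; rewrite aE dy linear0.
- by move=> k; apply: pr_exact.
- by move=> k dk; apply: P0.
Qed.

Lemma pdim_le d M : (pdim M <= (d%:Z)%:E)%E <-> pd_le d M.
Proof.
split=> [/least_le[k kd [P P0]]|Md].
  by apply: pd_leW kd _; apply: resolution_pd_le P0.
by apply/least_le; exists d => //; apply: pd_le_resolution.
Qed.

Lemma gldim_le d : (gldim A <= (d%:Z)%:E)%E <->
  forall M, finitely_generated M -> pd_le d M.
Proof.
split=> [/least_le[k kd H] M Mfg|H].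
  by apply: pd_leW kd _; apply/pdim_le; apply: (H (FgMod Mfg)).
by apply/least_le; exists d => // M; apply/pdim_le/H; case: M.
Qed.

(* [M/U] is finitely presented: if [P_1 -> P_0 -> M/U -> 0] is exact and [k]
   lifts [P_0 -> M/U] to [M], then [U] is generated by the image of [P_1]
   under [k] and by the differences between the generators of [M] and
   elements of the image of [k]. *)
Lemma fg_submodules_pd d :
  (forall M, finitely_generated M -> pd_le d M) -> fg_submodules A.
Proof.
move=> pdA L M f f_inj Mfg.
have [N [q [q_surj qE]]] := quotient_module (submodule_im f).
have /pd_leS[K [P [i [p [Pfg Pp [i_inj ip p_surj] /pd_le_fg/fgP[s sK]]]]]] :=
  pdA N (fg_surj q_surj Mfg).
have [k kE] := Pp _ _ q p q_surj.
have /fgP[t tM] := Mfg.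
have [j jE] : exists j : {linear K -> L}, forall x, f (j x) = k (i x).
  by apply: (factor_inj (h := k \o i : {linear K -> M})) => // x; apply/qE;
    rewrite /= kE; apply/ip; exists x.
have dif : forall x : M, exists z : P, exists y : L, f y = x - k z.
  move=> x; have [z pz] := p_surj (q x); exists z.
  by apply/qE; rewrite linearB kE pz subrr.
have [r rE] := choice dif; have [y yE] := choice rE.
apply/fgP; exists (map j s ++ map y t) => U Us stU.
have jU : forall x, U (j x).
  apply: (sK _ (submodule_preim j Us)) => x xs; apply: stU.
  by rewrite mem_cat map_f.
have MU : forall x : M, exists z u, U u /\ x = f u + k z.
  apply: tM => [|x xt].
    split; first by exists 0, 0; rewrite !linear0 addr0; split=> //;
      apply: sub0.
    move=> a _ _ [z [u [uU ->]]] [z' [u' [u'U ->]]];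
      exists (a *: z + z'), (a *: u + u').
    by split; [exact: Us.2 | rewrite !linearP scalerDr addrACA].
  exists (r x), (y x); split; last by rewrite yE subrK.
  by apply: stU; rewrite mem_cat map_f ?orbT.
move=> x; have [z [u [uU fx]]] := MU (f x).
have [|w iw] := (ip z).1.
  rewrite -kE; apply/qE; exists (x - u); rewrite linearB fx.
  by rewrite [f u + _]addrC addrK.
have -> : x = u + j w by apply: f_inj; rewrite linearD jE iw.
exact: subD.
Qed.

(** One step of the horseshoe lemma: [g''] lifts to [X] as [P''] is projective, and the kernel of
    the resulting [P' * P'' -> X] is an extension of the two kernels. *)
Lemma short_exact_sum K' P' X' K'' P'' X'' X
    (i' : {linear K' -> P'}) (g' : {linear P' -> X'})
    (i'' : {linear K'' -> P''}) (g'' : {linear P'' -> X''})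
    (f : {linear X' -> X}) (g : {linear X -> X''}) :
  short_exact i' g' -> short_exact i'' g'' -> projective P'' ->
  short_exact f g ->
  exists K (u : {linear K' -> K}) (v : {linear K -> K''})
      (i : {linear K -> (P' * P'')%type}) (h : {linear (P' * P'')%type -> X}),
    short_exact u v /\ short_exact i h.
Proof.
move=> [i'_inj i'g' g'_surj] [i''_inj i''g'' g''_surj] P''p [f_inj fg g_surj].
have [k kE] := P''p _ _ g g'' g_surj.
have gf x : g (f x) = 0 by apply/fg; exists x.
have [|h hE] := @linear_exists A (P' * P'')%type X (fun x => f (g' x.1) + k
  x.2).
  by move=> a x y; rewrite /= !linearP scalerDr addrACA.
have h_surj : surj h.
  move=> x; have [y gy] := g''_surj (g x).
  have [|z fz] := (fg (x - k y)).1; first by rewrite linearB kE gy subrr.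
  by have [w gw] := g'_surj z; exists (w, y); rewrite hE /= gw fz subrK.
have [K [i ih]] := kernel_module h_surj; have [i_inj ihE _] := ih.
have hi x : f (g' (i x).1) + k (i x).2 = 0 by rewrite -hE; apply/ihE; exists x.
have [a x y|p1 p1E] := @linear_exists A K P' (fun x => (i x).1);
  first by rewrite linearP.
have [a x y|p2 p2E] := @linear_exists A K P'' (fun x => (i x).2);
  first by rewrite linearP.
have [x|v vE] := factor_inj i''_inj (h := p2).
  by apply/i''g''; have := congr1 g (hi x);
    rewrite linearD gf add0r linear0 kE p2E.
have [|j jE] := @linear_exists A K' (P' * P'')%type (fun x => (i' x, 0)).
  by move=> a x y; rewrite linearP; congr pair; rewrite /= scaler0 addr0.
have [x|u uE] := factor_inj i_inj (h := j).
  by apply/ihE; rewrite hE jE /= linear0 addr0 (_ : g' _ = 0) ?linear0 //;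
    apply/i'g'; exists x.
exists K, u, v, i, h; split=> //; split.
- by move=> x y uxy; apply: i'_inj; have := uE x; rewrite uxy uE !jE => -[].
- move=> y; split=> [vy|[x <-]]; last first.
    by apply: i''_inj; rewrite vE p2E uE jE linear0.
  have iy2 : (i y).2 = 0 by rewrite -p2E -vE vy linear0.
  have [|x ix] := (i'g' (i y).1).1.
    by apply: f_inj; have := hi y; rewrite iy2 !linear0 addr0.
  by exists x; apply: i_inj; rewrite uE jE ix -iy2; case: (i y).
- move=> y.
  have [|x fx] := (fg (k (i'' y))).1; first by rewrite kE; apply/i''g'';
    exists y.
  have [x' gx'] := g'_surj x.
  have [|z iz] := (ihE (- x', i'' y)).1.
    by rewrite hE /= !linearN gx' fx addNr.
  by exists z; apply: i''_inj; rewrite vE p2E iz.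
Qed.

Lemma pd_le_ext d L M N (f : {linear L -> M}) (g : {linear M -> N}) :
  short_exact f g -> pd_le d L -> pd_le d N -> pd_le d M.
Proof.
elim: d L M N f g => [|d IH] L M N f g fg.
  case=> Lfg Lp [Nfg Np]; split; first exact: fg_ext fg Lfg Nfg.
  have [f_inj fgE g_surj] := fg.
  have [s sE] := Np _ _ g idfun g_surj.
  have [|h hE] := @linear_exists A (L * N)%type M (fun x => f x.1 + s x.2).
    by move=> a x y; rewrite /= !linearP scalerDr addrACA.
  apply: (@projective_iso (L * N)%type M h); last exact: projective_pair.
  apply: inj_surj_bij => [|y].
    apply: linear_eq0_inj => -[x y]; rewrite hE /= => xy0.
    have y0 : y = 0.
      by have := congr1 g xy0; rewrite linearD (short_exact0 fg) sE add0r
        linear0.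
    by move: xy0; rewrite y0 linear0 addr0 -(linear0 f) => /f_inj ->.
  have [|x fx] := (fgE (y - s (g y))).1; first by rewrite linearB sE subrr.
  by exists (x, g y); rewrite hE /= fx subrK.
move=> [K' [P' [i' [g' [P'fg P'p e' K'd]]]]] [K'' [P'' [i'' [g'' [P''fg P''p
  e'' K''d]]]]].
have [K [u [v [i [h [uv ih]]]]]] := short_exact_sum e' e'' P''p fg.
exists K, (P' * P'')%type, i, h; split=> //;
  [exact: fg_pair | exact: projective_pair |].
exact: IH uv K'd K''d.
Qed.

(** A relation, because a syzygy depends on the chosen presentations. *)
Fixpoint syzygy (d : nat) M X : Prop :=
  if d is d'.+1 then
    exists (Y P : lmodType A) (f : {linear X -> P}) (g : {linear P -> Y}),
      [/\ syzygy d' M Y, finitely_generated P, projective P, short_exact f g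
        & finitely_generated X]
  else M = X /\ finitely_generated X.

Lemma syzygy_fg d M X : syzygy d M X -> finitely_generated X.
Proof. by case: d => [[]|d [Y [P [f [g []]]]]]. Qed.

Lemma syzygy_exists d M : fg_submodules A -> finitely_generated M ->
  exists X, syzygy d M X.
Proof.
move=> Anoeth Mfg; elim: d => [|d [Y MY]]; first by exists M.
have [P [g [Pfg Pp g_surj]]] := free_cover (syzygy_fg MY).
have [X [f fg]] := kernel_module g_surj.
by exists X, Y, P, f, g; split=> //; apply: (Anoeth _ _ f) => //; case: fg.
Qed.

Lemma syzygy_pd_le d k M X : syzygy d M X -> pd_le k X -> pd_le (d + k) M.
Proof.
elim: d k X => [|d IH] k X; first by case=> ->.
move=> [Y [P [f [g [MY Pfg Pp fg _]]]]] Xk; rewrite addSnnS; apply: IH MY _.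
by exists X, P, f, g.
Qed.

End ProjectiveDimension.

(** * Vanishing of Ext^1 *)

Section ExtVanishing.
Variable A : pzRingType.
Implicit Types (E I K L M N P Q T V W X Y Z : lmodType A).

(* Ext^1(X, N) = 0 *)
Definition ext0 X N := forall K V (f : {linear K -> V}) (g : {linear V -> X}),
  short_exact f g -> forall h : {linear K -> N},
  exists k : {linear V -> N}, forall x, k (f x) = h x.

(** One projective presentation suffices as a test: any other extension [V] is a pushout of [P]
    along [j : K -> K'], so that a morphism on [V] is a compatible pair of morphisms on [P] and on
    [K']. *)
Lemma ext0_of_projective K P X N (f : {linear K -> P}) (g : {linear P -> X}) :
  short_exact f g -> projective P ->
  (forall h : {linear K -> N}, exists k : {linear P -> N}, forall x,
    k (f x) = h x) ->
  ext0 X N.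
Proof.
move=> fg Pp ext K' V f' g' [f'_inj fg' g'_surj] h;
  have [f_inj fgE g_surj] := fg.
have [l lE] := Pp _ _ g' g g'_surj.
have [x|j jE] := factor_inj f'_inj (h := l \o f : {linear K -> V}).
  by apply/fg'; rewrite /= lE; apply/fgE; exists x.
have [k kE] := ext (h \o j : {linear K -> N}).
pose R v n := exists p x, v = l p + f' x /\ n = k p + h x.
have R0 n : R 0 n -> n = 0.
  case=> p [x [v0 ->]].
  have [|y fy] := (fgE p).1.
    by rewrite -lE; have := congr1 g' v0;
      rewrite linearD linear0 (fg' (f' x)).2 ?addr0 //; exists x.
  have : f' (j y + x) = f' 0 by rewrite linearD jE /= fy -v0 linear0.
  by move/f'_inj => jx; rewrite -fy kE /= -linearD jx linear0.
have Rlin a v v' n n' : R v n -> R v' n' -> R (a *: v + v') (a *: n + n').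
  case=> p [x [-> ->]] [p' [x' [-> ->]]]; exists (a *: p + p'), (a *: x + x').
  by rewrite !linearP !scalerDr; split; apply: addrACA.
have [v|v n n' Rn Rn'||r rE] := @linear_of_rel A V N R.
- have [p gp] := g_surj (g' v).
  have [|x fx] := (fg' (v - l p)).1; first by rewrite linearB lE gp subrr.
  by exists (k p + h x), p, x; rewrite fx addrC subrK.
- apply/eqP; rewrite -subr_eq0; apply/eqP/R0.
  by have := Rlin (-1) _ _ _ _ Rn' Rn; rewrite !scaleN1r addNr [- n' + _]addrC.
- exact: Rlin.
exists r => x; have Rx : R (f' x) (h x) by exists 0, x; rewrite !linear0 !add0r.
apply/eqP; rewrite -subr_eq0; apply/eqP/R0.
by have := Rlin (-1) _ _ _ _ Rx (rE (f' x));
  rewrite !scaleN1r addNr [- h x + _]addrC.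
Qed.

Lemma ext0_trivial X N : trivial_mod X -> ext0 X N.
Proof.
move=> X0 K V f g [f_inj fg _] h.
have [|f' [fK f'K]] := bijective_iso (f := f).
  by apply: inj_surj_bij => // y; apply/fg; apply: X0.
by exists (h \o f' : {linear V -> N}) => x /=; rewrite fK.
Qed.

(** [W] is the preimage of [X1] in [V]. A morphism extends from [K] to [W], whose quotient by [K] is
    [X1], and then to [V], whose quotient by [W] is [X2]. *)
Lemma ext0_ext X1 X X2 N (f : {linear X1 -> X}) (g : {linear X -> X2}) :
  short_exact f g -> ext0 X1 N -> ext0 X2 N -> ext0 X N.
Proof.
move=> [f_inj fg g_surj] N1 N2 K V i p [i_inj ip p_surj] h.
have gp_surj : surj (g \o p).
  by move=> y; have [x <-] := g_surj y; have [v <-] := p_surj x; exists v.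
have [W [w wgp]] := @kernel_module A V X2 (g \o p : {linear V -> X2}) gp_surj.
have [w_inj wE _] := wgp.
have [x|j jE] := factor_inj w_inj (h := i).
  by apply/wE; rewrite /= (ip (i x)).2 ?linear0 //; exists x.
have [x|q qE] := factor_inj f_inj (h := p \o w : {linear W -> X}).
  by apply/fg; apply/wE; exists x.
have [|k kE] := N1 K W j q _ h; last first.
  by have [m mE] := N2 _ _ _ _ wgp k; exists m => x; rewrite -jE mE kE.
split=> [x y jxy|y|x].
- by apply: i_inj; rewrite -!jE jxy.
- split=> [qy|[x <-]].
    by have [|x ix] := (ip (w y)).1; [rewrite -[p _]qE qy linear0 | exists x;
      apply: w_inj; rewrite jE].
  by apply: f_inj; rewrite qE /= jE linear0; apply/ip; exists x.
- have [v pv] := p_surj (f x); have [|y wy] := (wE v).1.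
    by rewrite /= pv; apply/fg; exists x.
  by exists y; apply: f_inj; rewrite qE /= wy.
Qed.

Lemma ext0_iso X Y N (f : {linear X -> Y}) : bijective f -> ext0 X N ->
  ext0 Y N.
Proof.
move=> /bijective_iso[f' [fK f'K]] XN K V i p ip.
apply: (XN K V i (f' \o p : {linear V -> X})).
by apply: short_exact_isor ip; exists f.
Qed.

Lemma ext0_summand X T N : ext0 (X * T)%type N -> ext0 X N.
Proof.
move=> XTN K V f g [f_inj fg g_surj] h.
have [|i iE] := @linear_exists A K (V * T)%type (fun x => (f x, 0)).
  by move=> a x y; rewrite linearP; congr pair; rewrite /= scaler0 addr0.
have [|p pE] := @linear_exists A (V * T)%type (X * T)%type (fun x => (g x.1,
  x.2)).
  by move=> a x y; rewrite linearP.
have [|k kE] := XTN _ _ i p _ h.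
  split=> [x y|[v t]|[x t]].
  - by rewrite !iE => -[/f_inj].
  - rewrite pE; split=> [[/fg[x <-] /= ->]|[x]]; first by exists x; rewrite iE.
    by rewrite iE => -[<- <-] /=; congr pair; apply/fg; exists x.
  - by have [v <-] := g_surj x; exists (v, t); rewrite pE.
have [|j jE] := @linear_exists A V (V * T)%type (fun x => (x, 0)).
  by move=> a x y; congr pair; rewrite /= scaler0 addr0.
by exists (k \o j : {linear V -> N}) => x; rewrite /= jE -iE.
Qed.

Lemma ext0_section N Z X (f : {linear N -> Z}) (g : {linear Z -> X}) :
  ext0 X N -> short_exact f g -> exists s : {linear X -> Z}, cancel s g.
Proof.
move=> XN fg; have [r rE] := XN _ _ f g fg idfun; have [f_inj fgE g_surj] := fg.
have [z gz|s sE] := factor_surj g_surj (h := idfun \- (f \o r) : {linear Z ->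
  Z}).
  by have [x <-] := (fgE z).1 gz; rewrite /= rE subrr.
exists s => x; have [z <-] := g_surj x.
by rewrite sE /= linearB (short_exact0 fg) subr0.
Qed.

(** [Z] is the pushout of [N] and [V] along [K]. A section [s] of [Z -> X] corrects [j : V -> Z] to
    [j - s g], which takes its values in [N]. *)
Lemma ext0_of_section X N :
  (forall Z (f : {linear N -> Z}) (g : {linear Z -> X}), short_exact f g ->
     exists s : {linear X -> Z}, cancel s g) -> ext0 X N.
Proof.
move=> split_XN K V f g [f_inj fg g_surj] h.
pose U (u : (N * V)%type) := exists x, u = (h x, - f x).
have Us : submodule U.
  split; first by exists 0; rewrite !linear0 ?oppr0.
  move=> a _ _ [x ->] [y ->]; exists (a *: x + y); rewrite !linearP.
  by congr pair; rewrite /= opprD scalerN.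
have [Z [q [q_surj qU]]] := quotient_module Us.
have [|i iE] := @linear_exists A N Z (fun n => q (n, 0)).
  by move=> a x y; rewrite -linearP; congr (q _); congr pair;
    rewrite /= scaler0 addr0.
have [|j jE] := @linear_exists A V Z (fun v => q (0, v)).
  by move=> a x y; rewrite -linearP; congr (q _); congr pair;
    rewrite /= scaler0 addr0.
have [|p' p'E] := @linear_exists A (N * V)%type X (fun u => g u.2).
  by move=> a x y; rewrite linearP.
have [u|p pE] := factor_surj q_surj (h := p').
  by move/qU => [x ->]; rewrite p'E /= linearN (fg (f x)).2 ?oppr0 //; exists x.
have ij x : j (f x) = i (h x).
  apply/eqP; rewrite -subr_eq0 -oppr_eq0 opprB iE jE -linearB; apply/eqP/qU.
  by exists x; congr pair; rewrite /= ?subr0 ?sub0r.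
have ip : short_exact i p.
  split.
  - apply: linear_eq0_inj => n; rewrite iE => /qU[x [-> /esym/eqP]].
    by rewrite oppr_eq0 -(linear0 f) => /eqP /f_inj ->; rewrite linear0.
  - move=> z; have [[n v] <-] := q_surj z; rewrite pE p'E /=.
    split=> [/fg[x <-]|[m]].
      exists (n + h x); rewrite linearD -ij iE jE -linearD.
      by congr (q _); congr pair; rewrite /= ?addr0 ?add0r.
    rewrite iE => /eqP; rewrite -subr_eq0 -linearB => /eqP/qU[x [_ /= /eqP]].
    by rewrite sub0r eqr_opp => /eqP ->; apply/fg; exists x.
  - by move=> x; have [v <-] := g_surj x; exists (q (0, v)); rewrite pE p'E.
have [s sK] := split_XN _ i p ip; have [i_inj ipE _] := ip.
have pj v : p (j v) = g v by rewrite jE pE p'E.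
have [v|k kE] := factor_inj i_inj (h := j \- (s \o g) : {linear V -> Z}).
  by apply/ipE; rewrite /= linearB sK pj subrr.
have gf x : g (f x) = 0 by apply/fg; exists x.
by exists k => x; apply: i_inj; rewrite kE /= ij gf linear0 subr0.
Qed.

(** Lift on a free cover of [X], then correct the lift by a morphism to [N] so that it vanishes on
    the kernel of the cover. *)
Lemma ext0_lift X N Z W (f : {linear N -> Z}) (g : {linear Z -> W})
    (h : {linear X -> W}) :
  finitely_generated X -> ext0 X N -> short_exact f g ->
  exists k : {linear X -> Z}, forall x, g (k x) = h x.
Proof.
move=> Xfg XN [f_inj fg g_surj].
have [P [p [_ Pp p_surj]]] := free_cover Xfg.
have [K [i ip]] := kernel_module p_surj; have [_ ipE _] := ip.
have [l lE] := Pp _ _ g (h \o p : {linear P -> W}) g_surj.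
have [x|j jE] := factor_inj f_inj (h := l \o i : {linear K -> Z}).
  by apply/fg; rewrite /= lE /= (short_exact0 ip) linear0.
have [k kE] := XN _ _ _ _ ip j.
have [x /ipE[y <-]|m mE] := factor_surj p_surj (h :=
  l \- (f \o k) : {linear P -> Z}).
  by rewrite /= kE jE subrr.
exists m => x; have [y <-] := p_surj x.
by rewrite mE /= linearB lE (fg (f _)).2 ?subr0 //; exists (k y).
Qed.

Lemma ext0_coext X N' N N'' (f : {linear N' -> N}) (g : {linear N -> N''}) :
  finitely_generated X -> short_exact f g -> ext0 X N' -> ext0 X N'' ->
    ext0 X N.
Proof.
move=> Xfg [f_inj fg g_surj] XN' XN''.
have [P [p [_ Pp p_surj]]] := free_cover Xfg.
have [K [i ip]] := kernel_module p_surj.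
apply: (ext0_of_projective ip Pp) => h.
have [a aE] := XN'' _ _ _ _ ip (g \o h : {linear K -> N''}).
have [b bE] := Pp _ _ g a g_surj.
have [x|c cE] := factor_inj f_inj (h := h \- (b \o i) : {linear K -> N}).
  by apply/fg; rewrite /= linearB bE aE subrr.
have [d dE] := XN' _ _ _ _ ip c.
by exists (b \+ (f \o d) : {linear P -> N}) => x;
  rewrite /= dE cE /= addrC subrK.
Qed.

(** Exactness of Hom(X, Q) -> Ext^1(X, E) -> Ext^1(X, N): a morphism extended with values in [N]
    induces [X -> Q], which is zero, so its values are in [E]. *)
Lemma ext0_sub X E N Q (f : {linear E -> N}) (g : {linear N -> Q}) :
  short_exact f g -> ext0 X N -> (forall (h : {linear X -> Q}) x, h x = 0) ->
  ext0 X E.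
Proof.
move=> [f_inj fg _] XN hom0 K V i p ip h; have [_ ipE p_surj] := ip.
have [a aE] := XN _ _ _ _ ip (f \o h : {linear K -> N}).
have gf x : g (f x) = 0 by apply/fg; exists x.
have [x /ipE[y <-]|m mE] := factor_surj p_surj (h := g \o a : {linear V -> Q}).
  by rewrite /= aE /= gf.
have [x|k kE] := factor_inj f_inj (h := a).
  by apply/fg; have := mE x; rewrite hom0.
by exists k => x; apply: f_inj; rewrite kE aE.
Qed.

(* Ext^1(X, N) = Ext^2(Y, N) = Ext^1(Y, N') *)
Lemma ext0_shift X P Y N I N' (f : {linear X -> P}) (g : {linear P -> Y})
    (i : {linear N -> I}) (q : {linear I -> N'}) :
  short_exact f g -> projective P -> short_exact i q -> ext0 X I ->
  ext0 Y N' -> ext0 X N.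
Proof.
move=> fg Pp iq XI YN' K V j p jp h.
have [i_inj iqE q_surj] := iq; have [_ jpE p_surj] := jp.
have [a aE] := XI _ _ _ _ jp (i \o h : {linear K -> I}).
have [x /jpE[y <-]|b bE] := factor_surj p_surj (h := q \o a : {linear V -> N'}).
  by rewrite /= aE /= (short_exact0 iq).
have [c cE] := YN' _ _ _ _ fg b.
have [d dE] := Pp _ _ q c q_surj.
have [x|k kE] := factor_inj i_inj (h := a \- (d \o f \o p) : {linear V -> I}).
  by apply/iqE; rewrite /= linearB dE cE bE subrr.
by exists k => x; apply: i_inj;
  rewrite kE /= aE (short_exact0 jp) !linear0 ?subr0 ?addr0.
Qed.

Lemma ext0_isor (X N N' : lmodType A) (f : {linear N -> N'}) :
  bijective f -> ext0 X N -> ext0 X N'.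
Proof.
move=> /bijective_iso[f' [fK f'K]] XN K V i p ip h.
have [k kE] := XN _ _ _ _ ip (f' \o h : {linear K -> N}).
by exists (f \o k : {linear V -> N'}) => x /=; rewrite kE /= f'K.
Qed.

Lemma ext0_trivialr (X N : lmodType A) : trivial_mod N -> ext0 X N.
Proof.
move=> N0 K V i p _ h.
have [|k kE] := @linear_exists A V N (fun=> 0).
  by move=> a x y; rewrite scaler0 addr0.
by exists k => x; rewrite kE (N0 (h x)).
Qed.

(** The pullback of [X] and [T] over [D] is an extension of [X] by [V] and also of [T] by [X']. The
    latter splits since [T] is projective, hence the form [X' * T]. *)
Lemma short_exact_pullback (V T X' X D : lmodType A)
    (i : {linear V -> T}) (p : {linear T -> D})
    (f : {linear X' -> X}) (g : {linear X -> D}) :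
  short_exact i p -> projective T -> short_exact f g ->
  exists (j : {linear V -> (X' * T)%type}) (q : {linear (X' * T)%type -> X}),
    short_exact j q.
Proof.
move=> [i_inj ip p_surj] Tp [f_inj fg g_surj].
have [l lE] := Tp _ _ g p g_surj.
have pi x : p (i x) = 0 by apply/ip; exists x.
have [x|r rE] := factor_inj f_inj (h := l \o i : {linear V -> X}).
  by apply/fg; rewrite /= lE pi.
have [|j jE] := @linear_exists A V (X' * T)%type (fun v => (- r v, i v)).
  by move=> a x y; rewrite !linearP; congr pair; rewrite /= opprD scalerN.
have [|q qE] := @linear_exists A (X' * T)%type X (fun u => f u.1 + l u.2).
  by move=> a x y; rewrite /= !linearP scalerDr addrACA.
exists j, q; split.
- by move=> x y; rewrite !jE => -[_ /i_inj].
- move=> [x t]; rewrite qE /=; split=> [xt|[v]].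
    have [|v iv] := (ip t).1.
      by have := congr1 g xt; rewrite linearD lE linear0 (fg (f x)).2 ?add0r
        //; exists x.
    exists v; rewrite jE iv; congr pair; apply: f_inj.
    rewrite linearN rE /= iv; apply/eqP; rewrite eq_sym -addr_eq0; exact/eqP.
  by rewrite jE => -[<- <-]; rewrite linearN rE /= addNr.
- move=> x; have [t pt] := p_surj (g x).
  have [|x' fx] := (fg (x - l t)).1; first by rewrite linearB lE pt subrr.
  by exists (x', t); rewrite qE /= fx subrK.
Qed.

(* injective dimension, tested against finitely generated modules only *)
Fixpoint id_le (d : nat) N : Prop :=
  if d is d'.+1 then
    exists I N' (i : {linear N -> I}) (q : {linear I -> N'}),
      [/\ short_exact i q, forall X, finitely_generated X -> ext0 X I &
        id_le d' N']
  else forall X, finitely_generated X -> ext0 X N.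

(** Each step trades one syzygy in the first argument for one cosyzygy in the second. *)
Lemma id_le_ext0 d N M X : id_le d N -> syzygy d M X -> ext0 X N.
Proof.
elim: d N X => [|d IH] N X /=; first by move=> NI [_ /NI].
move=> [I [N' [i [q [iq II N'd]]]]] [Y [P [f [g [MY Pfg Pp fg Xfg]]]]].
by apply: (ext0_shift fg Pp iq); [exact: II | exact: IH MY].
Qed.

End ExtVanishing.

(** * Restriction of scalars and tensor products *)

(** An alias of the carrier, so that the [B]-module structure does not compete with the [A]-module
    structure of [N]. *)
Definition restr (A B : pzRingType) (iota : {rmorphism B -> A})
  (N : lmodType A) : Type := N.

Section RestrictionOfScalars.
Variables (A B : pzRingType) (iota : {rmorphism B -> A}).

Section Module.
Variable N : lmodType A.

HB.instance Definition _ := GRing.Zmodule.on (restr iota N).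

Definition restr_scale (b : B) (x : restr iota N) : restr iota N :=
  iota b *: (x : N).

Lemma restr_scaleA a b x : restr_scale a (restr_scale b x) = restr_scale (a *
  b) x.
Proof. by rewrite /restr_scale scalerA rmorphM. Qed.

Lemma restr_scale1 : left_id 1 restr_scale.
Proof. by move=> x; rewrite /restr_scale rmorph1 scale1r. Qed.

Lemma restr_scaleDr : right_distributive restr_scale +%R.
Proof. by move=> a x y; rewrite /restr_scale scalerDr. Qed.

Lemma restr_scaleDl x : {morph restr_scale^~ x : a b / a + b}.
Proof. by move=> a b; rewrite /restr_scale rmorphD scalerDl. Qed.

HB.instance Definition _ := GRing.Zmodule_isLmodule.Build B (restr iota N)
  restr_scaleA restr_scale1 restr_scaleDr restr_scaleDl.

Lemma restrZ b (x : restr iota N) : b *: x = iota b *: (x : N). Proof. by [].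
  Qed.

End Module.

Lemma restr_map (M N : lmodType A) (h : {linear M -> N}) :
  exists h' : {linear restr iota M -> restr iota N}, forall x, h' x = h x.
Proof. by apply: linear_exists => a x y; rewrite restrZ linearP. Qed.

Lemma submodule_restr (M : lmodType A) (U : M -> Prop) :
  submodule U -> submodule (U : restr iota M -> Prop).
Proof. by case=> U0 Us; split=> // b x y; apply: Us. Qed.

Lemma restr_fg (M : lmodType A) :
  finitely_generated (restr iota M) -> finitely_generated M.
Proof.
move=> /fgP[s sM]; apply/fgP; exists s => U /submodule_restr; exact: sM.
Qed.

Lemma fg_restr (M : lmodType A) :
  finitely_generated (restr iota A^o) -> finitely_generated M ->
  finitely_generated (restr iota M).
Proof.
move=> /fgP[s sA] /fgP[t tM]; apply/fgP.
exists [seq (a : A) *: y : M | a <- (s : seq A), y <- t] => U Us stU.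
have aU (a : A) y : y \in t -> U (a *: y).
  move=> yt; apply: (sA (fun a : A => U (a *: y))) => [|b bs].
    split=> [|b c d cU dU]; first by rewrite scale0r; apply: (sub0 Us).
    rewrite restrZ scalerDl -scalerA; exact: Us.2.
  by apply: stU; apply/allpairsP; exists (b, y).
have MU : forall x : M, forall a : A, U (a *: x).
  apply: tM => [|y yt a]; last exact: aU.
  split=> [a|a x y xU yU b]; first by rewrite scaler0; apply: (sub0 Us).
  by rewrite scalerDr scalerA; apply: (subD Us).
by move=> x; rewrite -[x]scale1r; apply: MU.
Qed.

Lemma restr_artinian (M : lmodType A) : artinian (restr iota M) -> artinian M.
Proof.
move=> Mart U Uc; apply: Mart => k; apply/submoduleP.
by apply: submodule_restr; apply/submoduleP.
Qed.

Lemma fg_submodules_restr : finitely_generated (restr iota A^o) ->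
  fg_submodules B -> fg_submodules A.
Proof.
move=> Afg Bnoeth L M f f_inj Mfg; have [f' f'E] := restr_map f.
apply/restr_fg/(Bnoeth _ _ f'); last exact: fg_restr.
by move=> x y; rewrite !f'E => /f_inj.
Qed.

Lemma artinian_restr : finitely_generated (restr iota A^o) ->
  artinian B^o -> artinian A^o.
Proof. by move=> Afg Bart; apply/restr_artinian/fg_artinian. Qed.

Implicit Types (K L M Y : lmodType B) (N : lmodType A).

(** With [tensor_unit], this is the adjunction between [tensor iota] and [restr iota]. *)
Lemma tensor_adjoint M N (h : {linear M -> restr iota N}) :
  exists k : {linear tensor iota M -> N},
    forall a m, k (tensor_of iota a m) = a *: (h m : N).
Proof.
pose F (a : A) (m : M) : N := a *: (h m : N).
have FDl a a' m : F (a + a') m = F a m + F a' m by apply: scalerDl.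
have FDr a m m' : F a (m + m') = F a m + F a m' by rewrite /F linearD;
  apply: scalerDr.
have FM a b m : F (a * iota b) m = F a (b *: m).
  by rewrite /F linearZ /= restrZ scalerA.
have kE a m : tensor_lift F (tensor_of iota a m) = F a m by apply:
  tensor_lift_of.
have k_add : zmod_morphism (tensor_lift (iota :=
  iota) F) by apply: tensor_lift_is_additive.
pose k0 : {additive tensor iota M -> N} :=
  HB.pack (tensor_lift (iota := iota) F)
    (GRing.isZmodMorphism.Build (tensor iota M) N _ k_add).
have k0Z (a : A) x : k0 (a *: x) = a *: k0 x.
  pose k1 : {additive tensor iota M -> N} := k0 \o tensor_scale a.
  pose k2 : {additive tensor iota M -> N} := ( *:%R a) \o k0.
  apply: (tensor_eq (f := k1) (g := k2)) => b m.
  by rewrite /k1 /k2 /= tensor_scaleE !kE /F scalerA.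
have [|k kE'] := @linear_exists A (tensor iota M) N k0.
  by move=> a x y; apply: etrans (raddfD k0 _ _) _; congr (_ + _); apply: k0Z.
by exists k => a m; rewrite kE' /= kE.
Qed.

Lemma tensor_unit M :
  exists u : {linear M -> restr iota (tensor iota M)}, forall m,
    u m = tensor_of iota 1 m.
Proof.
apply: linear_exists => b x y; rewrite tensor_ofDr restrZ.
by rewrite [iota b *: _]tensor_scaleE -tensor_ofM mul1r mulr1.
Qed.

Lemma tensor_of1 (a : A) M (m : M) :
  tensor_of iota a m = a *: (tensor_of iota 1 m : tensor iota M).
Proof. by rewrite [RHS]tensor_scaleE mulr1. Qed.

Lemma tensor_linear_eq M N (f g : {linear tensor iota M -> N}) :
  (forall m, f (tensor_of iota 1 m) = g (tensor_of iota 1 m)) -> f =1 g.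
Proof.
move=> fg; have fgE a m : f (tensor_of iota a m) = g (tensor_of iota a m).
  by rewrite tensor_of1 !linearZ /= fg.
exact: (tensor_eq (f := f : {additive _ -> _}) (g := g : {additive _ ->
  _}) fgE).
Qed.

Lemma tensor_fg M : finitely_generated M -> finitely_generated (tensor iota M).
Proof.
move=> /fgP[s sM]; apply/fgP; exists (map (fun m => tensor_of iota 1 m) s) =>
  U Us sU.
have [u uE] := tensor_unit M.
have uU m : U (u m).
  apply: (sM _ (submodule_preim u (submodule_restr Us))) => x xs.
  by rewrite uE; apply/sU/map_f.
(* The projection modulo [U] agrees with the zero morphism on all 1 (x) m, hence everywhere. *)
have [Q [q [_ qU]]] := quotient_module Us.
move=> x; apply/qU.
have [|z zE] := @linear_exists A (tensor iota M) Q (fun=> 0).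
  by move=> a y y'; rewrite scaler0 addr0.
by rewrite (@tensor_linear_eq M Q q z) ?zE // => m; rewrite zE -uE; apply/qU.
Qed.

Lemma tensor_projective M : projective M -> projective (tensor iota M).
Proof.
move=> Mp X Y p h p_surj.
have [u uE] := tensor_unit M; have [p' p'E] := restr_map p.
have [h' h'E] := restr_map h.
have [|k kE] := Mp _ _ p' (h' \o u : {linear M -> restr iota Y}).
  by move=> y; have [x <-] := p_surj y; exists x.
have [k' k'E] := tensor_adjoint k; exists k'.
apply: (tensor_linear_eq (f := p \o k' : {linear tensor iota M -> Y})) => m /=.
by rewrite k'E scale1r -p'E kE /= h'E uE.
Qed.

Hypothesis iota_exact : tensor_exact iota.

Lemma tensor_short_exact K L M (f : {linear K -> L}) (g : {linear L -> M}) :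
  finitely_generated K -> finitely_generated L -> finitely_generated M ->
  short_exact f g -> short_exact (tensor_map iota f) (tensor_map iota g).
Proof. by move=> Kfg Lfg Mfg; apply: (@iota_exact (FgMod Kfg) (FgMod Lfg)
  (FgMod Mfg)). Qed.

Lemma tensor_pd_le d M : pd_le d M -> pd_le d (tensor iota M).
Proof.
elim: d M => [|d IH] M; first by case=> Mfg Mp; split;
  [exact: tensor_fg | exact: tensor_projective].
move=> Md; have Mfg := pd_le_fg Md; case: Md => K [P [f [g [Pfg Pp fg Kd]]]].
exists (tensor iota K), (tensor iota P), (tensor_map iota f),
  (tensor_map iota g).
split; [exact: tensor_fg | exact: tensor_projective | | exact: IH].
exact: tensor_short_exact (pd_le_fg Kd) Pfg Mfg fg.
Qed.

Hypothesis Bnoeth : fg_submodules B.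

(** A free presentation of [Y] tensors to a projective presentation of [tensor iota Y], so Ext^1
    over both rings is tested on adjoint morphisms. [Bnoeth] makes the kernel finitely generated, as
    [tensor_exact] requires. *)
Lemma ext0_tensor Y N : finitely_generated Y ->
  ext0 Y (restr iota N) -> ext0 (tensor iota Y) N.
Proof.
move=> Yfg YN; have [P [p [Pfg Pp p_surj]]] := free_cover Yfg.
have [K [i ip]] := kernel_module p_surj; have [i_inj _ _] := ip.
have Kfg := Bnoeth i_inj Pfg.
have e := tensor_short_exact Kfg Pfg Yfg ip.
apply: (ext0_of_projective e) => [|h]; first exact: tensor_projective.
have [u uE] := tensor_unit K; have [h' h'E] := restr_map h.
have [k kE] := YN _ _ _ _ ip (h' \o u : {linear K -> restr iota N}).
have [k' k'E] := tensor_adjoint k; exists k'.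
apply: (tensor_linear_eq (f :=
  k' \o tensor_map iota i : {linear tensor iota K -> N})) => m /=.
by rewrite tensor_map_of k'E scale1r kE /= h'E uE.
Qed.

Lemma ext0_restr Y N : finitely_generated Y ->
  ext0 (tensor iota Y) N -> ext0 Y (restr iota N).
Proof.
move=> Yfg YN; have [P [p [Pfg Pp p_surj]]] := free_cover Yfg.
have [K [i ip]] := kernel_module p_surj; have [i_inj _ _] := ip.
have Kfg := Bnoeth i_inj Pfg.
have e := tensor_short_exact Kfg Pfg Yfg ip.
apply: (ext0_of_projective ip) => // h.
have [h' h'E] := tensor_adjoint h.
have [k kE] := YN _ _ _ _ e h'.
have [u uE] := tensor_unit P; have [k' k'E] := restr_map k.
exists (k' \o u : {linear P -> restr iota N}) => x.
by rewrite /= k'E uE -[tensor_of _ _ _]tensor_map_of kE h'E scale1r.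
Qed.

End RestrictionOfScalars.

(** * Primitive idempotents *)

Section Idempotents.
Variable A : pzRingType.
Implicit Types (L M N P S : lmodType A) (e : A).

Definition killed e M := forall x : M, e *: x = 0.

Lemma killed_sub e L M (f : {linear L -> M}) : injective f -> killed e M ->
  killed e L.
Proof. by move=> f_inj eM x; apply: f_inj; rewrite linearZ linear0 /= eM. Qed.

Lemma killed_quotient e M N (g : {linear M -> N}) : surj g -> killed e M ->
  killed e N.
Proof. by move=> g_surj eM y; have [x <-] := g_surj y;
  rewrite -linearZ eM linear0. Qed.

Lemma killed_ext e L M N (f : {linear L -> M}) (g : {linear M -> N}) :
  e * e = e -> short_exact f g -> killed e L -> killed e N -> killed e M.
Proof.
move=> ee [_ fg _] eL eN x.
have [|y fy] := (fg (e *: x)).1; first by rewrite linearZ /= eN.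
by rewrite -ee -scalerA -fy -linearZ /= eL linear0.
Qed.

Lemma Ae_gen e : e * e = e ->
  exists u : Ae e, [/\ val u = e, e *: u = u & forall y : Ae e,
    y = (val y : A) *: u].
Proof.
move=> ee; have eAe : in_Ae e e by apply/asboolP; exists 1; rewrite mul1r.
exists (exist _ e eAe); split=> //; first exact/val_inj.
by move=> y; apply: val_inj => /=; case: y => y /= /asboolP[a ->];
  rewrite /GRing.scale /= -mulrA ee.
Qed.

Lemma Ae_hom e N (m : N) : e * e = e -> e *: m = m ->
  exists k : {linear Ae e -> N}, forall y, k y = (val y : A) *: m.
Proof.
by move=> ee em; apply: linear_exists => a x y; rewrite scalerA -scalerDl.
Qed.

Lemma Ae_fg e : e * e = e -> finitely_generated (Ae e).
Proof.
move=> ee; have [u [_ _ uE]] := Ae_gen ee; apply/fgP;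
  exists [:: u] => U Us uU x.
by rewrite (uE x); apply: (subZ Us); apply: uU; rewrite inE.
Qed.

Lemma Ae_projective e : e * e = e -> projective (Ae e).
Proof.
move=> ee M N g h g_surj; have [u [_ eu uE]] := Ae_gen ee.
have [m gm] := g_surj (h u).
have [|k kE] := @Ae_hom e M (e *: m) ee; first by rewrite scalerA ee.
by exists k => x; rewrite kE !linearZ /= gm -linearZ /= eu -linearZ -uE.
Qed.

Lemma iter_linear M (h : {linear M -> M}) m :
  exists k : {linear M -> M}, forall x, k x = iter m h x.
Proof.
elim: m => [|m [k kE]]; first by exists idfun.
by exists (h \o k : {linear M -> M}) => x; rewrite /= kE.
Qed.

(** The union of the kernels of all iterates is finitely generated, and one power kills its
    generators. *)
Lemma ker_stable M (h : {linear M -> M}) :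
  fg_submodules A -> finitely_generated M ->
  exists m, forall k x, iter k h x = 0 -> iter m h x = 0.
Proof.
move=> Anoeth Mfg.
have iter0 k : iter k h 0 = 0 by elim: k => //= k ->; rewrite linear0.
have iterW k l x : (k <= l)%N -> iter k h x = 0 -> iter l h x = 0.
  by move=> /subnK <- kx; rewrite iterD kx iter0.
have Us : submodule (fun x => exists k, iter k h x = 0).
  split=> [|a x y [k kx] [l ly]]; first by exists 0%N.
  exists (maxn k l); have [f fE] := iter_linear h (maxn k l).
  rewrite -fE; apply: (submodule_ker f).2; rewrite fE.
    by apply: iterW kx; rewrite leq_maxl.
  by apply: iterW ly; rewrite leq_maxr.
have [L [f [f_inj fE]]] := submodule_module Us.
have /fgP[s sL] := Anoeth _ _ f f_inj Mfg.
have [m mE] : exists m, forall y, y \in s -> iter m h (f y) = 0.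
  elim: (s) => [|y t [m mE]]; first by exists 0%N.
  have [k ky] := (fE (f y)).2 (ex_intro _ y erefl).
  exists (maxn k m) => z; rewrite inE => /orP[/eqP->|/mE mz].
    by apply: iterW ky; rewrite leq_maxl.
  by apply: iterW mz; rewrite leq_maxr.
exists m => k x kx; have [|y <-] := (fE x).1; first by exists k.
have [g gE] := iter_linear h m; rewrite -gE.
apply: (sL (fun y => g (f y) = 0)) => [|z zs]; last by rewrite gE mE.
exact: (submodule_preim f (submodule_ker g)).
Qed.

Lemma im_stable M (h : {linear M -> M}) : artinian M ->
  exists m, forall k x, (m <= k)%N -> exists y, iter m h x = iter k h y.
Proof.
move=> Mart.
have [||m mE] := Mart (fun k x => `[< exists y, iter k h y = x >]).
- move=> k; apply: submodule_asbool; have [f fE] := iter_linear h k.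
  have := submodule_im f; rewrite (_ : (fun x => exists y,
    f y = x) = (fun x => exists y, iter k h y = x)) //.
  by apply/funext => x; apply/propext; split=> -[y <-]; exists y; rewrite fE.
- by move=> k x /asboolP[y <-]; apply/asboolP; exists (h y); rewrite -iterSr.
exists m => k x mk.
have : iter m h x \in (fun z => `[< exists y, iter m h y = z >]).
  by apply/asboolP; exists x.
by rewrite -(mE k mk) => /asboolP[y yE]; exists y.
Qed.

(* Fitting's lemma: [Ae] is the direct sum of the kernel and of the image of a
   high power of [h], and the components of [e] are orthogonal idempotents. *)
Lemma primitive_endomorphism e (h : {linear Ae e -> Ae e}) :
  artinian A^o -> fg_submodules A -> primitive_idempotent e ->
  surj h \/ exists m, forall x, iter m h x = 0.
Proof.
move=> Aart Anoeth [e0 ee eprim].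
have [u [valu eu uE]] := Ae_gen ee; have Pfg := Ae_fg ee.
have [m1 m1E] := ker_stable h Anoeth Pfg.
have [m2 m2E] := im_stable h (fg_artinian Aart Pfg).
(* The successor makes [m] positive, so that an image under [iter m h] is an image under [h]. *)
pose m := (maxn m1 m2).+1.
have m1m : (m1 <= m)%N by rewrite leqW // leq_maxl.
have m2m : (m2 <= m)%N by rewrite leqW // leq_maxr.
have [g gE] := iter_linear h m.
have disj x y : g x = 0 -> g y = x -> x = 0.
  move=> gx gy; rewrite -gy gE -(subnK m1m) iterD (m1E (m + m)%N);
    last by rewrite iterD -!gE gy.
  by rewrite -[LHS]/(iter _ h 0); elim: (m - m1)%N => //= k ->; rewrite linear0.
have Ks := submodule_ker g; have Is := submodule_im g.
have [y [w yw]] : exists y w, g y = 0 /\ u = y + g w.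
  have [v vE] := m2E (m + m)%N u (leq_trans m2m (leq_addr _ _)).
  pose w := iter (m - m2) h v.
  exists (u - g w), w; rewrite subrK; split=> //.
  rewrite linearB !gE -{1}(subnK m2m) iterD vE -iterD addnC -addnA !iterD.
  by rewrite subrr.
have [gy uyz] := yw; set z := g w in uyz.
have split_u (x : Ae e) : x = (val x : A) *: y + (val x : A) *: z.
  by rewrite -scalerDr -uyz -uE.
(* As a multiple of [z] this element is in the image of [g], and as [y - (val y) *: y] it is in the
   kernel, so it vanishes. The product [(val z) *: y] is treated with the roles exchanged. *)
have gyz : g ((val y : A) *: z) = 0.
  have -> : (val y : A) *: z = y - (val y : A) *: y by rewrite {2}(split_u y)
    addrC addKr.
  exact: (subB Ks gy (subZ Ks _ gy)).
have yz : (val y : A) *: z = 0 by apply: (disj _ (val y *: w) gyz);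
  rewrite linearZ.
have zy : (val z : A) *: y = 0.
  have [v gv] : exists v, g v = (val z : A) *: y.
    have -> : (val z : A) *: y = z - (val z : A) *: z by rewrite {2}(split_u
      z) addrK.
    by apply: (subB Is); [exists w | apply: (subZ Is); exists w].
  by apply: disj gv; apply: (subZ Ks).
have yy : (val y : A) *: y = y by rewrite {3}(split_u y) yz addr0.
have zz : (val z : A) *: z = z by rewrite {3}(split_u z) zy add0r.
have [y0|z0] : (val y : A) = 0 \/ (val z : A) = 0.
  apply: eprim; first exact: (congr1 val yy).
  - exact: (congr1 val zz).
  - exact: (congr1 val yz).
  - exact: (congr1 val zy).
  - exact: etrans (esym valu) (congr1 val uyz).
- left => x; rewrite (uE x) uyz (_ : y = 0); last exact: val_inj.
  by rewrite add0r /z -linearZ gE /m iterS;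
    exists (iter (maxn m1 m2) h (val x *: w)).
- right; exists m => x; rewrite -gE (uE x) uyz (_ : z = 0); last exact: val_inj.
  by rewrite addr0 linearZ /= gy scaler0.
Qed.

Lemma simple_kernel_maximal M S (g : {linear M -> S}) :
  simple_mod S -> surj g -> maximal_submod (fun x => `[< g x = 0 >]).
Proof.
move=> Ssim g_surj; split; first exact/submodule_asbool/submodule_ker.
  move=> gT; apply: Ssim.1 => y; have [x <-] := g_surj y.
  by have := gT x; rewrite [x \in predT]inE => /asboolP.
move=> V Vc gV; have /submoduleP Vs := Vc.
have Is : submodule (fun y => exists2 x, x \in V & g x = y).
  split=> [|a _ _ [x xV <-] [y yV <-]]; first by exists 0;
    rewrite ?linear0 //; apply: (sub0 Vs).
  by exists (a *: x + y); rewrite ?linearP //; apply: Vs.2.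
have [V0|VT] := simpleP Ssim Is; [left|right] => x.
  by apply/idP/asboolP => [xV|gx]; [apply: V0; exists x | apply: gV;
    apply/asboolP].
rewrite [RHS]inE; have [y yV gxy] := VT (g x); rewrite -(subrK y x).
apply: (subD Vs) => //; apply: gV; apply/asboolP.
by rewrite linearB gxy subrr.
Qed.

Lemma maximal_quotient M (U : {pred M}) : maximal_submod U ->
  exists S (g : {linear M -> S}), [/\ simple_mod S, surj g & forall x,
    g x = 0 <-> x \in U].
Proof.
move=> [/submoduleP Us UT Umax]; have [S [g [g_surj gU]]] := quotient_module Us.
exists S, g; split=> //; apply: simpleI.
  by move=> S0; apply: UT => x; apply/gU; apply: S0.
move=> V Vs; have Vgs := submodule_asbool (submodule_preim g Vs).
have [x xU|VU|VT] := Umax _ Vgs.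
- by apply/asboolP; rewrite (gU x).2 //; apply: sub0.
- left => y Vy; have [x gx] := g_surj y; rewrite -gx; apply/gU; rewrite -VU.
  by apply/asboolP; rewrite gx.
- right => y; have [x <-] := g_surj y; apply/asboolP.
  by have := VT x; rewrite [x \in predT]inE.
Qed.

(* A second maximal submodule would yield a projection of [Ae] onto its simple
   quotient that factors through [ker g], hence an endomorphism of [Ae] which
   is neither surjective nor nilpotent. *)
Lemma primitive_rad e S (g : {linear Ae e -> S}) :
  artinian A^o -> fg_submodules A -> primitive_idempotent e ->
  simple_mod S -> surj g -> forall x, g x = 0 <-> in_rad x.
Proof.
move=> Aart Anoeth eprim Ssim g_surj x; have [e0 ee _] := eprim.
split=> [gx U Umax|xrad]; last first.
  by have /asboolP := xrad _ (simple_kernel_maximal Ssim g_surj).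
have [T [q [Tsim q_surj qU]]] := maximal_quotient Umax.
apply/qU; apply: contrapT => qx.
have [K [i [i_inj iE _]]] := kernel_module g_surj.
have [y iy] := (iE x).1 gx.
have qi_surj : surj (q \o i : {linear K -> T}).
  by apply: (@simple_surj _ _ _ (q \o i : {linear K -> T}) y) => //=;
    rewrite iy.
have [k kE] := Ae_projective ee q qi_surj.
have qh z : q (i (k z)) = q z by exact: kE.
have [h_surj|[m mE]] :=
    primitive_endomorphism (i \o k : {linear Ae e -> Ae e}) Aart Anoeth eprim.
  apply: Ssim.1 => s; have [z <-] := g_surj s; have [w <-] := h_surj z.
  by apply/iE; exists (k w).
apply: qx; have : q x = q (iter m (i \o k) x).
  by elim: (m) => //= j ->; rewrite qh.
by rewrite mE linear0.
Qed.

Lemma simple_top_exists e :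
  artinian A^o -> fg_submodules A -> primitive_idempotent e ->
  exists S, simple_top (Ae e) S.
Proof.
move=> Aart Anoeth eprim; have [e0 ee _] := eprim;
  have [u [valu _ _]] := Ae_gen ee.
have [|S [g [Ssim g_surj]]] := simple_quotient (Ae_fg ee).
  by move=> P0; move/eqP: e0; apply; rewrite -valu (P0 u).
exists S; split=> //; exists g; split=> //; exact: primitive_rad.
Qed.

(** A nonzero [e *: x] in [S] gives a surjection from [Ae e], and [primitive_rad] identifies its
    kernel. *)
Lemma simple_top_hom e S :
  artinian A^o -> fg_submodules A -> primitive_idempotent e ->
  simple_mod S -> ~ killed e S -> simple_top (Ae e) S.
Proof.
move=> Aart Anoeth eprim Ssim eS; have [e0 ee _] := eprim.
have [x ex] : exists x : S, e *: x <> 0.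
  by apply: contrapT => H; apply: eS => x; apply: contrapT => ex; apply: H;
    exists x.
have [|k kE] := @Ae_hom e S (e *: x) ee; first by rewrite scalerA ee.
have [u [valu eu uE]] := Ae_gen ee.
have k_surj : surj k by apply: (@simple_surj _ _ _ k u) => //;
  rewrite kE valu scalerA ee.
split=> //; exists k; split=> //; exact: primitive_rad.
Qed.

Lemma simple_top_iso M S S' : simple_top M S -> simple_top M S' -> iso_mod S S'.
Proof.
move=> [Ssim [p [p_surj pE]]] [S'sim [p' [p'_surj p'E]]].
have [x /pE /p'E //|k kE] := factor_surj p_surj (h := p').
exists k; apply: inj_surj_bij => [|y]; last by have [x <-] := p'_surj y;
  exists (p x).
apply: linear_eq0_inj => y; have [x <-] := p_surj y.
by rewrite kE => /p'E /pE.
Qed.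

Lemma simple_top_nkilled e S : e * e = e -> simple_top (Ae e) S -> ~ killed e S.
Proof.
move=> ee [[S0 _] [p [p_surj _]]] eS; apply: S0 => y; have [x <-] := p_surj y.
have [u [_ eu uE]] := Ae_gen ee.
by rewrite (uE x) linearZ /= -eu linearZ /= eS scaler0.
Qed.

Lemma composition_series M : artinian A^o -> fg_submodules A ->
  finitely_generated M ->
  exists s, filtration s M /\ forall S, List.In S s -> simple_mod S.
Proof.
move=> Aart Anoeth; move: M; apply: submodule_ind => // M Mfg IH.
have [M0|M0] := pselect (trivial_mod M); first by exists [::]; split=> //;
  constructor.
have [S [g [Ssim g_surj]]] := simple_quotient Mfg M0.
have [L [f fg]] := kernel_module g_surj; have [f_inj _ _] := fg.
have [||s [sL ssim]] := IH L f f_inj; last first.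
- by exists (S :: s); split=> [|T [<-//|]];
    [apply: filtration_cons fg sL | apply: ssim].
- exact: Anoeth f_inj Mfg.
- by move=> f_surj; apply: Ssim.1 => y; have [x <-] := g_surj y;
    have [z <-] := f_surj x; rewrite (short_exact0 fg).
Qed.

(** Split off a simple quotient [T]. If [e] kills the kernel then it does not kill [T], which is
    therefore the top of [Ae e]; otherwise the factor is found in the kernel. *)
Lemma composition_factor_exists e S M :
  artinian A^o -> fg_submodules A -> primitive_idempotent e ->
  simple_top (Ae e) S -> finitely_generated M -> ~ killed e M ->
  composition_factor S M.
Proof.
move=> Aart Anoeth eprim Stop; have [_ ee _] := eprim.
move: M; apply: (@submodule_ind _ (fun M => ~ killed e M ->
  composition_factor S M)) => //.
move=> M Mfg IH eM.
have [|T [g [Tsim g_surj]]] := simple_quotient Mfg.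
  by move=> M0; apply: eM => x; rewrite (M0 x) scaler0.
have [L [f fg]] := kernel_module g_surj; have [f_inj _ _] := fg.
have Lfg := Anoeth _ _ _ f_inj Mfg.
have [eL|eL] := pselect (killed e L).
  have [s [sL ssim]] := composition_series Aart Anoeth Lfg.
  exists (T :: s); split; first exact: filtration_cons fg sL.
    by move=> X [<-//|]; apply: ssim.
  exists T; first by left.
  have eT : ~ killed e T by move=> eT; apply: eM; apply: killed_ext fg eL eT.
  exact: simple_top_iso (simple_top_hom Aart Anoeth eprim Tsim eT) Stop.
have f_nsurj : ~ surj f.
  by move=> f_surj; apply: Tsim.1 => y; have [x <-] := g_surj y;
    have [z <-] := f_surj x; rewrite (short_exact0 fg).
have [s [sL ssim [X Xs XS]]] := IH L f f_inj f_nsurj Lfg eL.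
exists (T :: s); split; first exact: filtration_cons fg sL.
  by move=> Y [<-//|]; apply: ssim.
by exists X => //; right.
Qed.

Lemma composition_factor_nkilled e S M : e * e = e ->
  simple_top (Ae e) S -> composition_factor S M -> ~ killed e M.
Proof.
move=> ee Stop [s [sM _ [T Ts [f f_bij]]]].
have eT : ~ killed e T.
  move=> eT; apply: (simple_top_nkilled ee Stop).
  by apply: (killed_quotient (g := f)) eT => y; have [f' _ f'K] := f_bij;
    exists (f' y).
elim: sM Ts => {s M} [//|s L M N i g [i_inj _ g_surj] _ IH [NT|/IH eL]] eM.
  by apply: eT; rewrite -NT; exact: killed_quotient g_surj eM.
by apply: eL; exact: killed_sub i_inj eM.
Qed.

End Idempotents.

(** * Exactness of a duality *)

Section Duality.
Variables (A : pzRingType) (n : nat) (e : 'I_n -> A) (phi : duality e).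
Implicit Types (L M N P X Y Z : fgmod A).
Local Notation D f := (dual_map phi f).

Lemma dual_comp_eq L M N (f : {linear L -> M}) (g : {linear M -> N})
    (h : {linear L -> N}) :
  (forall x, g (f x) = h x) -> forall y, D f (D g y) = D h y.
Proof.
move=> gf y; have := dual_comp (d := phi) f g y; rewrite /= => <-.
by apply: dual_ext => x; rewrite /= gf.
Qed.

Lemma dual_id_eq M (f : {linear M -> M}) : f =1 id -> D f =1 id.
Proof. by move=> f1 y; rewrite -[RHS](@dual_id _ _ _ phi M y);
  apply: dual_ext => x; rewrite f1. Qed.

Lemma dual_faithful M N (f g : {linear M -> N}) : D f =1 D g -> f =1 g.
Proof.
move=> fg x; apply: (bij_inj (dual_inv_bij phi N)).
have := dual_inv_nat phi f x; have := dual_inv_nat phi g x => /= <- <-.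
by apply: dual_ext.
Qed.

(** [f] is [D h] conjugated by [dual_inv]. That its dual is [h] is checked after one more
    dualisation, where naturality computes [D (D f)]. *)
Lemma dual_full M N (h : {linear phi N -> phi M}) :
  exists f : {linear M -> N}, D f =1 h.
Proof.
have [i [iK Ki]] := bijective_iso (dual_inv_bij phi N).
pose f : {linear M -> N} := i \o D h \o dual_inv phi M.
exists f; apply: dual_faithful => y;
  have [x <-] : exists x, dual_inv phi M x = y.
  by have [j _ jK] := dual_inv_bij phi M; exists (j y).
by have := dual_inv_nat phi f x => /= ->; rewrite /f /= Ki.
Qed.

(** Additivity of [phi] is not given. The identity and the zero morphism of [phi Z] have equal
    duals, because [phi (phi Z)] is a copy of [Z], and faithfulness makes them equal. *)
Lemma dual_trivial Z : trivial_mod Z -> trivial_mod (phi Z).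
Proof.
move=> Z0 y.
have [|o oE] := @linear_exists A (phi Z) (phi Z) (fun=> 0).
  by move=> a x x'; rewrite scaler0 addr0.
rewrite -(oE y); apply: (dual_faithful (f := idfun)) => z.
have [i [iK Ki]] := bijective_iso (dual_inv_bij phi Z).
by rewrite -(Ki z) (Z0 (i z)) !linear0.
Qed.

(** A zero morphism is one that factors through a trivial module, a property that functors keep once
    trivial modules are preserved. *)
Lemma dual0 M N (f : {linear M -> N}) : (forall x, f x = 0) -> forall y,
  D f y = 0.
Proof.
move=> f0 y; have [Z Z0] := trivial_exists A.
pose Z' := FgMod (fg_trivial Z0).
have [|o oE] := @linear_exists A M Z' (fun=> 0).
  by move=> a x x'; rewrite scaler0 addr0.
have [|o' o'E] := @linear_exists A Z' N (fun=> 0).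
  by move=> a x x'; rewrite scaler0 addr0.
rewrite -(@dual_comp_eq _ _ _ o o' f) => [|x]; last by rewrite o'E f0.
by rewrite (@dual_trivial Z' Z0 (D o' y)) linear0.
Qed.

Lemma dual_eq0 M N (f : {linear M -> N}) : (forall y, D f y = 0) -> forall x,
  f x = 0.
Proof.
move=> Df0 x.
have [|o oE] := @linear_exists A M N (fun=> 0).
  by move=> a y y'; rewrite scaler0 addr0.
by rewrite (@dual_faithful _ _ f o) // => y; rewrite Df0 (@dual0 _ _ o).
Qed.

(** An element [y] of [phi N] is a morphism from the regular module, taken as [Ae 1]. Up to the
    double dual it is the dual of some [b]; if [D g y = 0] then [b \o g] is zero, and so is [b],
    since [g] is onto. *)
Lemma dual_inj M N (g : {linear M -> N}) : surj g -> injective (D g).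
Proof.
move=> g_surj; apply: linear_eq0_inj => y gy.
have A1 : (1 : A) * 1 = 1 by rewrite mulr1.
have [u [valu _ _]] := Ae_gen A1.
pose P := FgMod (Ae_fg A1).
have [|a aE] := @Ae_hom A 1 (phi N) y A1; first by rewrite scale1r.
have [i [iK Ki]] := bijective_iso (dual_inv_bij phi P).
have [b bE] := @dual_full N (phi P) (a \o i : {linear phi (phi P) -> phi N}).
have b0 : forall x, b x = 0.
  have bg0 : forall x, b (g x) = 0.
    apply: (@dual_eq0 M (phi P) (b \o g : {linear M -> phi P})) => z.
    rewrite -(@dual_comp_eq _ _ _ g b (b \o g)) // bE /= aE linearZ /= gy.
    by rewrite scaler0.
  by move=> x; have [x' <-] := g_surj x.
by have := bE (dual_inv phi P u); rewrite (dual0 b0) /= iK aE valu scale1r.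
Qed.

(* A morphism from [phi M] to its quotient by the image of [D g] is, up to
   isomorphism, the dual of a morphism to [M]. *)
Lemma dual_cokernel M N (g : {linear M -> N}) :
  exists (C : fgmod A) (k : {linear C -> M}),
    (forall x, g (k x) = 0) /\ forall y, D k y = 0 <-> exists z, D g z = y.
Proof.
have [C [c [c_surj cE]]] := quotient_module (submodule_im (D g)).
pose C' := FgMod (fg_surj c_surj (fgmodP (phi M))).
pose c' : {linear phi M -> C'} := c.
have [k kE] := @dual_full (phi C') M (dual_inv phi C' \o c' : {linear _ -> _}).
exists (phi C'), k; split.
  apply: (@dual_eq0 _ _ (g \o k : {linear phi C' -> N})) => z.
  rewrite -(@dual_comp_eq _ _ _ k g (g \o k)) // kE /= /c' (cE _).2 ?linear0 //.
  by exists z.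
move=> y; rewrite kE /= -cE; split=> [|cy]; last by rewrite /c' cy linear0.
by rewrite -(linear0 (dual_inv phi C')) => /(bij_inj (dual_inv_bij phi C')).
Qed.

Lemma dual_surj L M (f : {linear L -> M}) : injective f -> surj (D f).
Proof.
move=> f_inj y; have [C [k [fk kE]]] := dual_cokernel f.
apply/kE; apply: dual0 => x; apply: f_inj.
by rewrite fk linear0.
Qed.

Lemma dual_short_exact L M N (f : {linear L -> M}) (g : {linear M -> N}) :
  short_exact f g -> short_exact (D g) (D f).
Proof.
move=> fg; have [f_inj fgE g_surj] := fg; split;
  [exact: dual_inj| |exact: dual_surj].
move=> y; have [C [k [gk kE]]] := dual_cokernel g.
split=> [fy|[z <-]]; last first.
  have [|o oE] := @linear_exists A L N (fun=> 0).
    by move=> a x x'; rewrite scaler0 addr0.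
  by rewrite (@dual_comp_eq _ _ _ f g o) ?(dual0 oE) // => x;
    rewrite oE (short_exact0 fg).
apply/kE; have [x|l lE] := factor_inj f_inj (h := k); first by apply/fgE.
by rewrite -(@dual_comp_eq _ _ _ l f k lE) fy linear0.
Qed.

Lemma dual_retraction L M (f : {linear L -> M}) (s : {linear phi L -> phi M}) :
  cancel s (D f) -> exists r : {linear M -> L}, cancel f r.
Proof.
move=> sK; have [r rE] := dual_full s; exists r => x.
apply: (dual_faithful (f := r \o f : {linear L -> L}) (g := idfun)) => y.
by rewrite -(@dual_comp_eq _ _ _ f r (r \o f)) // rE sK dual_id_eq.
Qed.

(** The dual of an extension of [X] by [phi Y] is an extension of a copy of [Y] by [phi X]. It has a
    section, which is the dual of a retraction of the original extension. *)
Lemma ext0_dual X Y : ext0 Y (phi X) -> ext0 X (phi Y).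
Proof.
move=> YX; apply: ext0_of_section => Z f g fg; have [f_inj fgE g_surj] := fg.
pose Z' := FgMod (fg_ext fg (fgmodP (phi Y)) (fgmodP X)).
pose f' : {linear phi Y -> Z'} := f; pose g' : {linear Z' -> X} := g.
have YYX := ext0_iso (dual_inv_bij phi Y) YX.
have [s sK] := ext0_section YYX (@dual_short_exact _ Z' _ f' g' fg).
have [r rK] := dual_retraction sK.
have [z gz|t tE] := factor_surj g_surj (h :=
  idfun \- (f' \o r) : {linear Z' -> Z'}).
  by have [x <-] := (fgE z).1 gz; rewrite /= (rK x) subrr.
exists t => x; have [z <-] := g_surj x.
by rewrite tE /= linearB (short_exact0 fg) subr0.
Qed.

Lemma dual_injective M : fg_submodules A -> projective M ->
  forall X : lmodType A, finitely_generated X -> ext0 X (phi M).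
Proof.
move=> Anoeth Mp X Xfg; have [P [p [Pfg Pp p_surj]]] := free_cover Xfg.
have [K [i ip]] := kernel_module p_surj; have [i_inj _ _] := ip.
apply: (ext0_of_projective ip Pp) => h.
pose K' := FgMod (Anoeth _ _ _ i_inj Pfg); pose P' := FgMod Pfg.
pose h' : {linear K' -> phi M} := h; pose i' : {linear K' -> P'} := i.
have [t tE] := Mp _ _ (D i') (D h' \o dual_inv phi M : {linear _ ->
  _}) (@dual_surj K' P' i' i_inj).
have [j [jK Kj]] := bijective_iso (dual_inv_bij phi M).
have [k kE] := @dual_full P' (phi M) (t \o j : {linear _ -> _}).
exists k; apply: (@dual_faithful K' _ (k \o i' : {linear K' -> phi M}) h') => y.
by rewrite -(@dual_comp_eq _ _ _ i' k (k \o i')) // kE /= tE /= Kj.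
Qed.

Lemma dual_id_le d M : fg_submodules A -> pd_le d M -> id_le d (phi M).
Proof.
move=> Anoeth; elim: d M => [|d IH] M; first by case=> _ Mp X Xfg;
  apply: dual_injective.
move=> [K [P [f [g [Pfg Pp fg Kd]]]]].
pose K' := FgMod (pd_le_fg Kd); pose P' := FgMod Pfg.
exists (phi P'), (phi K'), (dual_map phi (g : {linear P' -> M})),
  (dual_map phi (f : {linear K' -> P'})).
split; [exact: (@dual_short_exact K' P' M) |
  exact: (@dual_injective P' Anoeth Pp) | exact: IH].
Qed.

(** Otherwise [phi M] contains a nonzero image [T] of [Ae (e j)], and [T] has E(j) as a quotient.
    Dually, E(j), being preserved by [phi], embeds in [phi T], a quotient of a copy of [M]. *)
Lemma dual_killed M j : artinian A^o -> fg_submodules A ->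
  primitive_idempotent (e j) -> killed (e j) M -> killed (e j) (phi M).
Proof.
move=> Aart Anoeth eprim eM y; have [_ ee _] := eprim; apply: contrapT => ey.
have [|a aE] := @Ae_hom A (e j) (phi M) (e j *: y) ee;
  first by rewrite scalerA ee.
have [T [i [q [i_inj q_surj iq]]]] := image_module a.
have Tfg := fg_surj q_surj (Ae_fg ee).
have [u [valu eu uE]] := Ae_gen ee.
have qu : q u <> 0.
  by move=> q0; apply: ey; have := iq u; rewrite q0 linear0 aE valu scalerA ee.
have [|S [p [Ssim p_surj]]] := simple_quotient Tfg; first by move=> T0;
  apply: qu.
have eS : ~ killed (e j) S.
  move=> eS; apply: Ssim.1 => s; have [t <-] := p_surj s;
    have [x <-] := q_surj t.
  by rewrite (uE x) !linearZ /= -eu !linearZ /= eS scaler0.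
have Stop := simple_top_hom Aart Anoeth eprim Ssim eS.
pose S' := FgMod (fg_surj p_surj Tfg); pose T' := FgMod Tfg.
have [f f_bij] := @dual_simple _ _ _ phi j S' Stop.
have Dp_inj := @dual_inj T' S' p p_surj.
have Di_surj := @dual_surj T' (phi M) i i_inj.
apply: eS; apply: (killed_quotient (g := f)).
  by move=> s; have [f' _ f'K] := f_bij; exists (f' s).
apply: killed_sub Dp_inj _; apply: killed_quotient Di_surj _.
apply: (killed_quotient (g := dual_inv phi M)) eM => z.
by have [f' _ f'K] := dual_inv_bij phi M; exists (f' z).
Qed.

End Duality.

(** * Standard modules *)

Section StandardModules.
Variables (A : pzRingType) (n : nat) (e : 'I_n -> A).
Hypotheses (Aart : artinian A^o) (Anoeth : fg_submodules A).
Hypothesis e_prim : forall i, primitive_idempotent (e i).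
Implicit Types (D K L M N R S X : lmodType A).

Let ee i : e i * e i = e i. Proof. by case: (e_prim i). Qed.

Lemma no_factor_aboveP i M : finitely_generated M ->
  no_factor_above e i M <-> forall j : 'I_n, (i < j)%N -> killed (e j) M.
Proof.
move=> Mfg; split=> [Mi j ij|Mi j S ij Stop cf]; last first.
  exact: composition_factor_nkilled (ee j) Stop cf (Mi j ij).
apply: contrapT => ejM.
have [S Stop] := simple_top_exists Aart Anoeth (e_prim j).
apply: (Mi j S ij Stop); exact: composition_factor_exists Stop Mfg ejM.
Qed.

Lemma standard_fg i D : standard e i D -> finitely_generated D.
Proof. by case=> _ [p [p_surj _]]; apply: fg_surj p_surj (Ae_fg (ee i)). Qed.

Lemma standard_killed i D : standard e i D ->
  forall j : 'I_n, (i < j)%N -> killed (e j) D.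
Proof. by move=> Di; apply/no_factor_aboveP;
  [exact: standard_fg Di | case: Di]. Qed.

(** The universal property in terms of elements. That of [standard] concerns surjections only, hence
    the passage through an image. *)
Lemma standard_gen i D : standard e i D ->
  exists d : D, [/\ e i *: d = d, forall y, exists a : A, y = a *: d
    & forall N (x : N), e i *: x = x -> (forall j : 'I_n, (i < j)%N ->
      killed (e j) N) ->
        exists h : {linear D -> N}, h d = x].
Proof.
move=> Di; have [_ [p [p_surj pE]]] := Di.
have [u [valu eu uE]] := Ae_gen (ee i).
exists (p u); split=> [|y|N x ex Ni].
- by rewrite -linearZ /= eu.
- by have [z <-] := p_surj y; exists (val z); rewrite -linearZ /= -uE.
have [k kE] := Ae_hom (ee i) ex.
have [T [j [q [j_inj q_surj jq]]]] := image_module k.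
have [|h hE] := pE T q q_surj.
  apply/no_factor_aboveP; first exact: fg_surj q_surj (Ae_fg (ee i)).
  by move=> m im; apply: killed_sub j_inj (Ni m im).
by exists (j \o h : {linear D -> N}); rewrite /= -hE jq kE valu.
Qed.

(** A nonzero [e i *: x] in [R] would be the value at the generator [d] of a nonzero endomorphism of
    [D]; as this is invertible, [d] itself would lie in [R]. *)
Lemma standard_top i D : standard e i D -> division_endomorphism_ring D ->
  exists S R (f : {linear R -> D}) (g : {linear D -> S}),
    [/\ is_E e i S, short_exact f g
      & forall j : 'I_n, (i <= j)%N -> killed (e j) R].
Proof.
move=> Di [D0 Ddiv]; have [d [ed dE dh]] := standard_gen Di.
have [S [g [Ssim g_surj]]] := simple_quotient (standard_fg Di) D0.
have [R [f fg]] := kernel_module g_surj; have [f_inj fgE _] := fg.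
have gd : g d <> 0.
  move=> gd; apply: Ssim.1 => y; have [x <-] := g_surj y.
  by have [a ->] := dE x; rewrite linearZ /= gd scaler0.
exists S, R, f, g; split=> // [|j].
  apply: (simple_top_hom Aart Anoeth (e_prim i) Ssim) => eS.
  by apply: gd; rewrite -ed linearZ /= eS.
rewrite leq_eqVlt => /orP[/eqP/val_inj <- {j}|ij]; last first.
  exact: killed_sub f_inj (standard_killed Di ij).
move=> x; apply: contrapT => ex.
have [||h hd] := dh D (f (e i *: x)); [|exact: standard_killed Di|].
  by rewrite -linearZ /= scalerA ee.
have [|k [hK kK]] := Ddiv h.
  exists d; apply/eqP; rewrite hd => fx; apply: ex; apply: f_inj.
  by rewrite fx linear0.
have [a ka] := dE (k d); apply: gd; apply/fgE; exists (a *: (e i *: x)).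
by rewrite linearZ /= -hd -linearZ /= -ka kK.
Qed.

(* The kernel of [P(i) -> Delta(i)] is generated by the [e_m P(i)], [m > i]. *)
Lemma ext0_standard i D N : standard e i D ->
  (forall j : 'I_n, (i < j)%N -> killed (e j) N) -> ext0 D N.
Proof.
move=> Di Ni; have [_ [p [p_surj pE]]] := Di.
have {}Di := standard_killed Di.
have [K [f fp]] := kernel_module p_surj; have [f_inj fpE _] := fp.
apply: (ext0_of_projective fp (Ae_projective (ee i))) => h.
pose P := Ae (e i).
pose T (y : P) := forall U : P -> Prop, submodule U ->
  (forall (m : 'I_n) (z : P), (i < m)%N -> U (e m *: z)) -> U y.
have Ts : submodule T.
  split=> [U Us _|a x y xT yT U Us eU]; first exact: (sub0 Us).
  by apply: Us.2; [exact: xT | exact: yT].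
have [Q [q [q_surj qT]]] := quotient_module Ts.
have [|k kE] := pE Q q q_surj.
  apply/no_factor_aboveP; first exact: fg_surj q_surj (Ae_fg (ee i)).
  move=> m im y; have [z <-] := q_surj y; rewrite -linearZ; apply/qT => U Us;
    exact.
(* A generator [e m *: z] of the kernel is [f y] with [e m *: y = y], so [h y] lies in [e m *: N],
   which is zero. *)
have h0 x : h x = 0.
  have /qT fxT : q (f x) = 0 by rewrite kE (short_exact0 fp) linear0.
  have [||x' /f_inj -> //] := fxT (fun y => exists2 x', y = f x' & h x' = 0).
    split=> [|a _ _ [y -> hy] [z -> hz]]; first by exists 0; rewrite linear0.
    by exists (a *: y + z); rewrite linearP // hy hz scaler0 addr0.
  move=> m z im; have [|y fy] := (fpE (e m *: z)).1;
    first by rewrite linearZ /= Di.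
  have ey : e m *: y = y by apply: f_inj; rewrite linearZ /= fy scalerA ee.
  by exists y => //; rewrite -ey linearZ /= Ni.
have [|o oE] := @linear_exists A P N (fun=> 0).
  by move=> a x y; rewrite scaler0 addr0.
by exists o => x; rewrite oE h0.
Qed.

Variable phi : duality e.
Implicit Types (E F : fgmod A).

Lemma dual_standard_killed i F : standard e i F ->
  forall j : 'I_n, (i < j)%N -> killed (e j) (phi F).
Proof. by move=> Fi j ij; apply: dual_killed => //;
  apply: standard_killed Fi j ij. Qed.

(** If j < i, no factor of [phi F] lies above i. If i <= j, the duality exchanges the roles of [E]
    and [F]. *)
Lemma ext0_standard_costandard i j E F : standard e i E -> standard e j F ->
  ext0 E (phi F).
Proof.
move=> Ei Fj; have [ij|ji] := leqP i j; last first.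
  apply: (ext0_standard Ei) => k ik; apply: (dual_standard_killed Fj).
  exact: ltn_trans ji ik.
apply: ext0_dual; apply: (ext0_standard Fj) => k jk.
apply: (dual_standard_killed Ei); exact: leq_ltn_trans ij jk.
Qed.

Hypothesis e_sum : \sum_i e i = 1.

Lemma simple_is_E S : simple_mod S -> exists i, is_E e i S.
Proof.
move=> Ssim; apply: contrapT => nE; apply: Ssim.1 => x.
rewrite -[x]scale1r -e_sum scaler_suml big1 // => i _.
suff : killed (e i) S by apply.
by apply: contrapT => eS; apply: nE; exists i; apply: simple_top_hom.
Qed.

Lemma is_E_nkilled i S : is_E e i S -> ~ killed (e i) S.
Proof. exact: simple_top_nkilled (ee i). Qed.

Lemma fg_is_E_quotient M : finitely_generated M -> ~ trivial_mod M ->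
  exists i S (g : {linear M -> S}), is_E e i S /\ surj g.
Proof.
move=> Mfg M0; have [S [g [Ssim g_surj]]] := simple_quotient Mfg M0.
by have [i iS] := simple_is_E Ssim; exists i, S, g.
Qed.

Variables (Delta : 'I_n -> fgmod A) (d : nat).
Hypothesis Delta_standard : forall i, standard e i (Delta i).
Hypothesis Delta_div : forall i, division_endomorphism_ring (Delta i).
Hypothesis Delta_pd : forall i, pd_le d (Delta i).
(** The vanishing of Ext^2(Delta i, phi (Delta j)), expressed on a first syzygy [V] of [Delta i]. *)
Hypothesis Delta_ext : forall i, exists (V T : lmodType A) (f : {linear V -> T})
    (g : {linear T -> Delta i}),
  [/\ projective T, short_exact f g & forall j, ext0 V (phi (Delta j))].

(** * Mapping a module onto a standard module of minimal label *)

Section Peel.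
Variables (X : lmodType A) (i : 'I_n).
Hypothesis Xfg : finitely_generated X.
Hypothesis X_ext : forall j, ext0 X (phi (Delta j)).
Hypothesis X_min : forall j S (g : {linear X -> S}), is_E e j S -> surj g ->
  (i <= j)%N.

(** A nonzero image would have a simple quotient E(j) with i <= j by [X_min], although [e j] kills
    [M]. *)
Lemma hom_eq0 M : finitely_generated M ->
  (forall j : 'I_n, (i <= j)%N -> killed (e j) M) ->
  forall (h : {linear X -> M}) x, h x = 0.
Proof.
move=> Mfg Mi h x; have [T [f [q [f_inj q_surj fq]]]] := image_module h.
have [T0|T0] := pselect (trivial_mod T);
  first by rewrite -fq (T0 (q x)) linear0.
have [j [S [g [Sj g_surj]]]] := fg_is_E_quotient (Anoeth f_inj Mfg) T0.
have ij : (i <= j)%N.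
  apply: (X_min (g := g \o q : {linear X -> S}) Sj) => y.
  by have [t <-] := g_surj y; have [z <-] := q_surj t; exists z.
case: (is_E_nkilled Sj); apply: killed_quotient g_surj _.
exact: killed_sub f_inj (Mi j ij).
Qed.

(* [E(j)] is the socle of [phi (Delta j)] and the cokernel has only composition
   factors [E(k)] with [k < j], so it admits no nonzero morphism from [X]. *)
Lemma ext0_simple (j : 'I_n) S : (j < i)%N -> is_E e j S -> ext0 X S.
Proof.
move=> ji Sj.
have [S0 [R [f [g [S0j fg Rj]]]]] :=
  standard_top (Delta_standard j) (Delta_div j).
have [f_inj _ g_surj] := fg.
pose R' := FgMod (Anoeth f_inj (fgmodP (Delta j))).
pose S' := FgMod (fg_surj g_surj (fgmodP (Delta j))).
have [a a_bij] := @dual_simple _ _ _ phi j S' S0j.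
have [b b_bij] := simple_top_iso S0j Sj.
apply: (ext0_isor b_bij); apply: (ext0_isor a_bij).
apply: (ext0_sub (@dual_short_exact _ _ _ phi R' (Delta j) S' f g fg) (@X_ext
  j)).
apply: hom_eq0 => [|k ik]; first exact: fgmodP.
by apply: dual_killed => //; apply: Rj; apply: leq_trans (ltnW ji) ik.
Qed.

Lemma ext0_below M : finitely_generated M ->
  (forall j : 'I_n, (i <= j)%N -> killed (e j) M) -> ext0 X M.
Proof.
move: M; apply: (@submodule_ind _ (fun M =>
  (forall j : 'I_n, (i <= j)%N -> killed (e j) M) -> ext0 X M)) => //.
move=> M Mfg IH Mi.
have [M0|M0] := pselect (trivial_mod M); first exact: ext0_trivialr.
have [j [S [g [Sj g_surj]]]] := fg_is_E_quotient Mfg M0.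
have [K [f fg]] := kernel_module g_surj; have [f_inj _ _] := fg.
have ji : (j < i)%N.
  rewrite ltnNge; apply/negP => ij; case: (is_E_nkilled Sj).
  exact: killed_quotient g_surj (Mi j ij).
apply: (ext0_coext Xfg fg); last exact: ext0_simple ji Sj.
apply: (IH K f f_inj) => [f_surj||k ik]; last exact: killed_sub f_inj (Mi k ik).
  case: Sj => [[S0 _] _]; apply: S0 => y; have [x <-] := g_surj y.
  by have [z <-] := f_surj x; rewrite (short_exact0 fg).
exact: Anoeth f_inj Mfg.
Qed.

Lemma standard_quotient S (h : {linear X -> S}) : is_E e i S -> surj h ->
  exists k : {linear X -> Delta i}, surj k.
Proof.
move=> Si h_surj.
have [S0 [R [f [g [S0i fg Ri]]]]] :=
  standard_top (Delta_standard i) (Delta_div i).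
have [f_inj fgE g_surj] := fg; have [b b_bij] := simple_top_iso Si S0i.
have Rfg := Anoeth f_inj (fgmodP (Delta i)).
have [k kE] := ext0_lift (b \o h : {linear X -> S0}) Xfg (ext0_below Rfg Ri) fg.
exists k => y; have [u [eu uE _]] := standard_gen (Delta_standard i).
have [b' _ b'K] := b_bij; have [x hx] := h_surj (b' (g u)).
(* [k x] and the generator [u] differ by an element of [R], which [e i] kills; so [k] maps
   [e i *: x] to [u]. *)
have [|r fr] := (fgE (k x - u)).1; first by rewrite linearB kE /= hx b'K subrr.
have [a ->] := uE y; exists (a *: (e i *: x)).
rewrite !linearZ /= -[k x](subrK u) -fr scalerDr -linearZ /= Ri // linear0.
by rewrite add0r eu.
Qed.

End Peel.

Lemma pd_le_of_ext0 X : finitely_generated X ->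
  (forall j, ext0 X (phi (Delta j))) -> pd_le d X.
Proof.
move: X; apply: (@submodule_ind _ (fun X =>
  (forall j, ext0 X (phi (Delta j))) -> pd_le d X)) => //.
move=> X Xfg IH X_ext.
have [X0|X0] := pselect (trivial_mod X); first exact: pd_le_trivial.
pose Q i := exists S (g : {linear X -> S}), is_E e i S /\ surj g.
have [i0 Qi0] := fg_is_E_quotient Xfg X0.
have Qi0' : `[< Q i0 >] by apply/asboolP.
case: (arg_minnP (P := fun i => `[< Q i >]) (fun i => nat_of_ord i) Qi0').
move=> i /asboolP[S [h [Si h_surj]]] i_min.
have X_min (j : 'I_n) (T : lmodType A) (g : {linear X -> T}) : is_E e j T ->
  surj g -> (i <= j)%N.
  by move=> Tj g_surj; apply: i_min; apply/asboolP; exists T, g.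
have [g g_surj] := standard_quotient Xfg X_ext X_min Si h_surj.
have [X' [f fg]] := kernel_module g_surj; have [f_inj _ _] := fg.
apply: (pd_le_ext fg) => //; apply: (IH X' f f_inj) => [f_surj||j].
- have [+ _] := Delta_div i; apply=> y; have [x <-] := g_surj y.
  by have [z <-] := f_surj x; rewrite (short_exact0 fg).
- exact: Anoeth f_inj Xfg.
(* [X'] is a summand of [X' * T], which is an extension of [X] by [V]. *)
have [V [T [a [b [Tp ab V_ext]]]]] := Delta_ext i.
have [u [v uv]] := short_exact_pullback ab Tp fg.
by apply: (ext0_summand (T := T)); apply: ext0_ext uv (V_ext j) (X_ext j).
Qed.

Lemma pd_le_double M : finitely_generated M -> pd_le (d + d) M.
Proof.
move=> Mfg; have [X MX] := syzygy_exists d Anoeth Mfg.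
apply: (syzygy_pd_le MX); apply: pd_le_of_ext0 (syzygy_fg MX) _ => j.
exact: id_le_ext0 (dual_id_le phi Anoeth (Delta_pd j)) MX.
Qed.

End StandardModules.

(** * Artin algebras and the bound on the global dimension *)

Lemma algebra_restr_fg (R : comNzRingType) (A B : algType R) (iota :
  {lrmorphism B -> A}) :
  finitely_generated (A : lmodType R) ->
    finitely_generated (restr iota (A^o : lmodType A)).
Proof.
move=> [m [s sA]]; exists m, s => x; have [c ->] := sA x.
exists (fun i => (c i)%:A); apply: eq_bigr => i _.
have iotaA k : iota k%:A = k%:A by rewrite linearZ /= rmorph1.
by rewrite -[RHS]/(iota (c i)%:A * s i) iotaA mulr_algl.
Qed.

Lemma algebra_artinian (R : comNzRingType) (A : algType R) :
  artin_algebra A -> artinian (A^o : lmodType A).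
Proof.
move=> [Rart Afg].
apply: (@artinian_restr A R (in_alg A)) => //.
have [m [s sA]] := Afg; exists m, s => x; have [c ->] := sA x.
exists c; apply: eq_bigr => i _.
by rewrite -[RHS]/((c i)%:A * s i) mulr_algl.
Qed.

Theorem theorem3p3 (R : comNzRingType) (A B : algType R)
    (hA : artin_algebra A) (hB : artin_algebra B)
    (n : nat) (e : 'I_n -> A)
    (he : complete_primitive_orthogonal e) (he_basic : basic e)
    (hqh : quasi_hereditary e)
    (phi : duality e)
    (f : 'I_n -> B) (iota : {lrmorphism B -> A})
    (hborel : exact_borel e f iota) :
  (gldim A <= 2%:E * gldim B)%E.
Proof.
have [gB|[d gB]] : gldim B = +oo%E \/ exists d : nat, gldim B = (d%:Z)%:E.
- rewrite /gldim /least; case: pselect => [h|_]; last by left.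
  by right; exists (ex_minn h).
- by rewrite gB gt0_muley ?leey.
rewrite gB (_ : 2%:E * _ = ((d + d)%N%:Z)%:E)%E; last first.
  by rewrite -EFinM mulr_natl mulr2n -PoszD.
have /gldim_le Bd : (gldim B <= (d%:Z)%:E)%E by rewrite gB.
apply/gldim_le => M Mfg.
have [iota_inj [[f_prim f_is_E f_simple] _] f_standard iota_exact D_standard]
  := hborel.
have [e_prim _ e_sum] := he; have [_ e_div] := hqh.
have Bnoeth : fg_submodules B := fg_submodules_pd Bd.
have Bart := algebra_artinian hB.
have Afg := algebra_restr_fg iota hA.2.
have Anoeth := fg_submodules_restr Afg Bnoeth.
have Aart := algebra_artinian hA.
have E_ex i : exists S : fgmod B, is_E f i S.
  have [S Stop] := simple_top_exists Bart Bnoeth (f_prim i).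
  have [_ [p [p_surj _]]] := Stop; have [_ ff _] := f_prim i.
  by exists (FgMod (fg_surj p_surj (Ae_fg ff))).
have [E EE] := choice E_ex.
pose Delta i := FgMod (tensor_fg (iota : {rmorphism B -> A}) (fgmodP (E i))).
have Delta_standard i : standard e i (Delta i).
  exact/D_standard/f_standard/EE.
(* Induction on [Y] reduces this to simple [Y], for which [tensor iota Y] is standard. *)
have restr_ext j (Y : lmodType B) : finitely_generated Y ->
  ext0 Y (restr iota (phi (Delta j))).
  move: Y; apply: (@submodule_ind _ _ Bart) => // Y Yfg IH.
  have [Y0|Y0] := pselect (trivial_mod Y); first exact: ext0_trivial.
  have [S [g [Ssim g_surj]]] := simple_quotient Yfg Y0.
  have [K [k kg]] := kernel_module g_surj; have [k_inj _ _] := kg.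
  apply: (ext0_ext kg).
    apply: (IH K k k_inj) => [k_surj|]; last exact: Bnoeth k_inj Yfg.
    by apply: Ssim.1 => y; have [x <-] := g_surj y; have [z <-] := k_surj x;
      rewrite (short_exact0 kg).
  have [i Si] := f_simple S Ssim; have Sfg := fg_surj g_surj Yfg.
  apply: (ext0_restr iota_exact Bnoeth Sfg).
  apply: (@ext0_standard_costandard _ _ e Aart Anoeth e_prim phi i j (FgMod
    (tensor_fg iota Sfg))) => //.
  exact/D_standard/f_standard.
apply: (pd_le_double Aart Anoeth e_prim (phi := phi) e_sum (Delta :=
  Delta)) => // i.
- exact: e_div (Delta_standard i).
- by apply: (tensor_pd_le iota_exact); apply: Bd; exact: fgmodP.
(* Tensoring a free presentation of [E i] gives the first syzygy of [Delta i]; its Ext^1 is computed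
   over [B] on [K]. *)
have [P [p [Pfg Pp p_surj]]] := free_cover (fgmodP (E i)).
have [K [k kp]] := kernel_module p_surj; have [k_inj _ _] := kp.
have Kfg := Bnoeth _ _ _ k_inj Pfg.
exists (tensor iota K), (tensor iota P), (tensor_map iota k),
  (tensor_map iota p).
split; [exact: tensor_projective |
  exact: tensor_short_exact (fgmodP (E i)) kp | ].
by move=> j; apply: (ext0_tensor iota_exact Bnoeth Kfg); apply: restr_ext.
Qed.
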